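(* Let $p$ be a prime number and let $\mathbb{F}$ be a finite field of characteristic $p$. For every integer $n \geq 5$, there exist a global function field $k$ over $\mathbb{F}$ and an unramified geometric Galois extension $K/k$ such that $\mathrm{Gal}(K/k) \cong \mathfrak{S}_n$, the symmetric group of degree $n$.
   Context: A global function field over $\mathbb{F}$ is a function field of one variable over the finite field $\mathbb{F}$ (with constant field $\mathbb{F}$). An extension $K/k$ of global function fields is geometric if the constant field of $K$ equals that of $k$ (i.e. no constant field extension occurs). ''Unramified'' means unramified at every place of $k$. *)

(* Defs.v *)
From HB Require Import structures.
From mathcomp Require Import all_boot all_order all_algebra all_fingroup all_field.
From mathcomp Require Import fraction.
Set Implicit Arguments. Unset Strict Implicit. Unset Printing Implicit Defensive.
Import Order.TTheory GRing.Theory Num.Theory.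
Local Open Scope ring_scope.

Definition ratfun (F : fieldType) : fieldType := {fraction {poly F}}.

Definition constF (F : fieldType) (L : fieldExtType (ratfun F)) (c : F) : L :=
  (@FracField.tofrac {poly F} (c%:P))%:A.

Definition constant_field_is_F (F : fieldType) (L : fieldExtType (ratfun F))
  (E : {vspace L}) : Prop :=
  forall y : L, y \in E ->
    (exists q : {poly F}, q != 0 /\ root (map_poly (@constF F L) q) y) ->
    exists c : F, y = constF L c.

(* Normalized discrete valuation w of the field E (given as a subfield of L),
   trivial on the constants F: w : E^x ->> Z multiplicative, ultrametric,
   surjective, w(c) = 0 for c in F^x.  (Values of w outside E^x are irrelevant.) *)
Definition is_normalized_dval (F : fieldType) (L : fieldExtType (ratfun F))
  (E : {vspace L}) (w : L -> int) : Prop :=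
  [/\ forall x y, x \in E -> y \in E -> x != 0 -> y != 0 -> w (x * y) = w x + w y,
      forall x y, x \in E -> y \in E -> x != 0 -> y != 0 -> x + y != 0 ->
        Num.min (w x) (w y) <= w (x + y),
      exists2 t, t \in E & (t != 0) && (w t == 1)
    & forall c : F, c != 0 -> w (constF L c) = 0].

(* K/k is unramified at every place of k: every place Q of K (a normalized
   discrete valuation w_Q of K trivial on F) has ramification index 1 over its
   restriction to k, i.e. w_Q restricted to k^x is still surjective onto Z.
   (Residue field extensions of finite fields are automatically separable.) *)
Definition unramified (F : fieldType) (L : fieldExtType (ratfun F))
  (k K : {vspace L}) : Prop :=
  forall w : L -> int, is_normalized_dval K w ->
    exists2 a, a \in k & (a != 0) && (w a == 1).

(* Main.v *)
Require Import Defs.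
From HB Require Import structures.
From mathcomp Require Import all_boot all_order all_algebra all_fingroup all_field.
From mathcomp Require Import generic_quotient mpoly zify ring.
From Stdlib Require Import Classical.
Set Implicit Arguments. Unset Strict Implicit. Unset Printing Implicit Defensive.
Import Order.TTheory GRing.Theory Num.Theory.
Local Open Scope ring_scope.

(** Let L be the splitting field over F(t) of f = g - t h, where g/h is a rational
    function of large prime degree m with few critical points and whose fibre over 0
    consists of a double zero and of simple ones. The inertia at t = 0 contains a
    transposition, so Gal(L / F(t)) is S_m; inertia acts trivially on constants and the
    transpositions generate S_m, so L has constant field F. Embed S_n in S_m as r copies
    of its natural action: a nontrivial element moves at least r roots of f. At each
    place the roots that are not simple modulo the place are fewer than r, hence the
    simple ones generate L over the fixed field k of S_n, and adjoining a simple root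
    does not ramify. *)

Lemma exists_minimal (T : Type) (P : T -> Prop) (f : T -> nat) x : P x ->
  exists2 y, P y & forall z, P z -> (f y <= f z)%N.
Proof.
have [n] := ubnP (f x); elim: n x => // n IHn x lt_fx Px.
have [[y Py lt_yx]|min_x] := classic (exists2 y, P y & (f y < f x)%N).
  by apply: IHn Py; apply: leq_trans lt_yx _.
by exists x => // z Pz; rewrite leqNgt; apply/negP=> lt_zx; apply: min_x; exists z.
Qed.

Lemma map_poly_lift (R S : nzRingType) (f : {rmorphism R -> S}) (P : {poly S}) :
  (forall i, exists a, f a = P`_i) -> exists P0, map_poly f P0 = P.
Proof.
move=> imP; have /fin_all_exists[a Da] (i : 'I_(size P)) := imP i.
exists (\poly_(i < size P) if insub i is Some k then a k else 0).
apply/polyP=> i; rewrite coef_map coef_poly; case: ltnP => [lti|lei].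
  by rewrite insubT /= Da.
by rewrite nth_default //; apply: rmorph0.
Qed.

(** * Valuations *)

Lemma local_ring_residue_field (A : comNzRingType) (m : {pred A}) (inv : A -> A) :
    idealr_closed m -> (forall x, x \notin m -> inv x * x = 1) ->
  exists (kappa : fieldType) (res : {rmorphism A -> kappa}),
    (forall x, (res x == 0) = (x \in m)) /\ (forall k, exists x, res x = k).
Proof.
move=> ideal_m mulVm.
pose I : idealr A := HB.pack (m : A -> bool) (isIdealr.Build A m ideal_m).
pose Q : comNzRingType := {ideal_quot I}.
pose res : {rmorphism A -> Q} := \pi_Q%qT.
have res_eq0 x : (res x == 0) = (x \in m).
  by rewrite -(rmorph0 res) -Quotient.idealrBE subr0.
pose invQ (q : Q) := if q == 0 then 0 else res (inv (repr q)).
have mulVQ q : q != 0 -> invQ q * q = 1.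
  rewrite /invQ => nzq; rewrite (negPf nzq) -{2}[q]reprK -rmorphM mulVm ?rmorph1 //.
  by rewrite -res_eq0 [res _]reprK.
have invQ0 : invQ 0 = 0 by rewrite /invQ eqxx.
pose kappa : fieldType := HB.pack (Q : Type) Q (GRing.ComNzRing_isField.Build Q mulVQ invQ0).
by exists kappa, res; split=> // k; exists (repr (k : Q)); apply: reprK.
Qed.

Record valuation (L : fieldType) := Valuation {
  valuation_fun :> L -> int;
  valuationM : forall x y, x != 0 -> y != 0 ->
    valuation_fun (x * y) = valuation_fun x + valuation_fun y;
  valuation_min : forall x y, x != 0 -> y != 0 -> x + y != 0 ->
    Num.min (valuation_fun x) (valuation_fun y) <= valuation_fun (x + y) }.

Section ValuationRing.

Variables (L : fieldType) (w : valuation L).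

Definition vge (c : int) : {pred L} := [pred x | (x == 0) || (c <= w x)].
Definition vint := vge 0.
Definition vmax := vge 1.

Lemma valuation1 : w 1 = 0.
Proof.
have : w 1 = w 1 + w 1 by rewrite -valuationM ?oner_neq0 // mulr1.
by move: (w 1) => a; lia.
Qed.

Lemma valuationN x : w (- x) = w x.
Proof.
have [->|nzx] := eqVneq x 0; first by rewrite oppr0.
have nzN1 : -1 != 0 :> L by rewrite oppr_eq0 oner_eq0.
have := valuationM w nzN1 nzN1; rewrite mulrNN mulr1 valuation1 => w2.
by rewrite -mulN1r valuationM //; lia.
Qed.

Lemma valuationV x : x != 0 -> w x^-1 = - w x.
Proof.
by move=> nzx; have := valuationM w nzx (invr_neq0 nzx); rewrite mulfV // valuation1; lia.
Qed.

Lemma vge_zmod_closed c : zmod_closed (vge c).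
Proof.
split=> [|x y]; rewrite !inE ?eqxx //.
have [->|nzx] := eqVneq x 0; first by rewrite sub0r oppr_eq0 valuationN.
have [->|nzy] := eqVneq y 0; first by rewrite subr0 (negPf nzx).
move=> /= cx cy; have [//|nzxy] := eqVneq (x - y) 0.
rewrite -oppr_eq0 in nzy; apply: le_trans (valuation_min w nzx nzy nzxy).
by rewrite le_min cx valuationN.
Qed.

HB.instance Definition _ c := GRing.isZmodClosed.Build L (vge c) (vge_zmod_closed c).

Lemma vgeM c d x y : x \in vge c -> y \in vge d -> x * y \in vge (c + d).
Proof.
rewrite !inE mulf_eq0; case: eqVneq => //= nzx; case: eqVneq => //= nzy cx dy.
by rewrite valuationM // lerD.
Qed.

Lemma vint_subring_closed : subring_closed vint.
Proof.
split=> [|x y|x y]; [by rewrite inE valuation1 orbT | exact: rpredB | exact: vgeM].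
Qed.

HB.instance Definition _ := GRing.isSubringClosed.Build L vint vint_subring_closed.

Record vring := VRing { vring_val :> L; vring_valP : vring_val \in vint }.

HB.instance Definition _ := [isSub for vring_val].
HB.instance Definition _ := [Choice of vring by <:].
HB.instance Definition _ := [SubChoice_isSubComNzRing of vring by <:].
HB.instance Definition _ := GRing.RMorphism.copy vring_val (val : vring -> L).

Implicit Types a b : vring.

Lemma vmax_vint : {subset vmax <= vint}.
Proof. by move=> x; rewrite !inE; case: eqP => //= _; lia. Qed.

Lemma vint_Nvmax x : x \in vint -> x \notin vmax -> x != 0 /\ w x = 0.
Proof. by rewrite !inE; case: eqP => //= _; lia. Qed.

Lemma Nvmax1 : 1 \notin vmax.
Proof. by rewrite inE oner_eq0 valuation1. Qed.

Lemma vintV x : x \notin vmax -> x^-1 \in vint.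
Proof.
by rewrite !inE invr_eq0; case: eqVneq => //= nzx; rewrite valuationV //; lia.
Qed.

Lemma vmaxV x : x \notin vint -> x^-1 \in vmax.
Proof.
by rewrite !inE invr_eq0; case: eqVneq => //= nzx; rewrite valuationV //; lia.
Qed.

Lemma vint_vmaxM x y : x \in vint -> y \in vmax -> x * y \in vmax.
Proof. exact: vgeM. Qed.

Lemma residue_field_exists : exists (kappa : fieldType) (res : {rmorphism vring -> kappa}),
  (forall a, (res a == 0) = (val a \in vmax)) /\ (forall k, exists a, res a = k).
Proof.
pose inv a : vring := insubd 0 (val a)^-1.
apply: (@local_ring_residue_field _ [pred a | val a \in vmax] inv).
  split=> [||a b c Mb Mc].
  - by rewrite !inE rmorph0 eqxx.
  - by rewrite !inE rmorph1 oner_eq0 valuation1.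
  - have : val a * val b + val c \in vmax by apply: rpredD Mc; apply: vint_vmaxM (valP a) Mb.
    by rewrite -rmorphM -rmorphD.
move=> a nMa; apply: val_inj; rewrite rmorphM /= insubdK ?vintV //= mulVf //.
by have [] := vint_Nvmax (valP a) nMa.
Qed.

Lemma polyOver_vintP (P : {poly L}) : P \is a polyOver vint ->
  exists P0 : {poly vring}, map_poly val P0 = P.
Proof.
by move=> /polyOverP OP; apply: map_poly_lift => i; exists (insubd 0 P`_i); rewrite /= insubdK.
Qed.

Lemma vring_primitive_part (P : {poly L}) : P != 0 ->
  exists i (P0 : {poly vring}), P`_i != 0 /\ P = P`_i *: map_poly val P0.
Proof.
move=> nzP; have lt0 : ((size P).-1 < size P)%N by rewrite prednK ?size_poly_gt0.
have nzlead : P`_(Ordinal lt0) != 0 by rewrite -lead_coefE lead_coef_eq0.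
case: (@Order.TotalTheory.arg_minP _ _ _ (Ordinal lt0) (fun i => P`_i != 0)
  (fun i : 'I_(size P) => w P`_i) nzlead) => i nzi min_i.
have [|P0 DP0] := @polyOver_vintP ((P`_i)^-1 *: P); last first.
  by exists i, P0; rewrite DP0 scalerA mulfV // scale1r.
apply/polyOverP=> k; rewrite coefZ inE mulf_eq0 invr_eq0 (negPf nzi) /=.
have [//|nzk] := eqVneq P`_k 0; have ltk : (k < size P)%N.
  by rewrite ltnNge; apply: contra nzk => /leq_sizeP->.
by rewrite valuationM ?invr_eq0 // valuationV // addrC subr_ge0 (min_i (Ordinal ltk)).
Qed.

End ValuationRing.

Section RestrictedValuation.

Variables (E L : fieldType) (j : {rmorphism E -> L}) (w : valuation L).

Fact restrict_valuationM x y : x != 0 -> y != 0 -> w (j (x * y)) = w (j x) + w (j y).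
Proof. by move=> nzx nzy; rewrite rmorphM valuationM ?fmorph_eq0. Qed.

Fact restrict_valuation_min x y : x != 0 -> y != 0 -> x + y != 0 ->
  Num.min (w (j x)) (w (j y)) <= w (j (x + y)).
Proof.
move=> nzx nzy nzxy; rewrite rmorphD; apply: valuation_min; rewrite ?fmorph_eq0 //.
by rewrite -rmorphD fmorph_eq0.
Qed.

Definition restrict_valuation := Valuation restrict_valuationM restrict_valuation_min.

End RestrictedValuation.

(* Let OE be the valuation ring of E, M its maximal ideal, and let D(z) generate modulo M
   the elements of OE[z] of positive value. Then P = Q0 D + T0 with T0 = 0 modulo M, and
   Q0(z) is a unit since the root is simple. If C(z) has positive value and C = Q D + T,
   then Q0(z) C(z) is the value at z of Q0 T - Q T0, whose coefficients lie in M: take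
   out the content and descend. *)
Section SimpleRoot.

Variables (E L : fieldType) (j : {rmorphism E -> L}) (w : valuation L).
Local Notation wE := (restrict_valuation j w).
Variables (kappa : fieldType) (res : {rmorphism vring wE -> kappa}).
Hypothesis res_eq0 : forall a, (res a == 0) = (val a \in vmax wE).
Hypothesis res_onto : forall k, exists a, res a = k.
Variable z : L.
Hypothesis Oz : z \in vint w.

Definition vring_eval : {rmorphism {poly vring wE} -> L} :=
  horner_morph (fun a : vring wE => mulrC z ((j \o val) a)).

Lemma vring_evalE C : vring_eval C = (map_poly j (map_poly val C)).[z].
Proof. by rewrite -map_poly_comp. Qed.
Local Notation ev := vring_eval.

Lemma vring_eval_vint C : ev C \in vint w.
Proof.
rewrite vring_evalE horner_coef rpred_sum // => i _; rewrite !coef_map /=.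
by rewrite rpredM ?rpredX //; have := valP C`_i; rewrite !inE fmorph_eq0.
Qed.

Lemma vring_eval_vmax C : map_poly res C = 0 -> ev C \in vmax w.
Proof.
move=> C0; rewrite vring_evalE horner_coef; elim/big_ind: _ => [|x y|i _].
- by rewrite inE eqxx.
- exact: rpredD.
rewrite !coef_map /= mulrC; apply: vint_vmaxM; first exact: rpredX.
by have := res_eq0 C`_i; rewrite -coef_map C0 coef0 eqxx !inE fmorph_eq0.
Qed.

Lemma vmax_eval_principal : exists2 D, ev D \in vmax w &
  forall C, ev C \in vmax w -> exists Q T, map_poly res T = 0 /\ C = Q * D + T.
Proof.
pose nontrivial C := ev C \in vmax w /\ map_poly res C != 0.
have [[C0 ntC0]|trivial] := classic (exists C, nontrivial C); last first.
  exists 0 => [|C Cz]; first by rewrite rmorph0 inE eqxx.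
  exists 0, C; rewrite mul0r add0r; split=> //.
  by apply/eqP/negPn/negP=> nzC; apply: trivial; exists C.
have [D [Dz nzD] minD] := exists_minimal (fun C => size (map_poly res C)) ntC0.
exists D => // C Cz.
have [|Q DQ] := @map_poly_lift _ _ res (map_poly res C %/ map_poly res D); first by move=> i.
have DR : map_poly res (C - Q * D) = map_poly res C %% map_poly res D.
  by rewrite rmorphB rmorphM /= DQ {1}(divp_eq (map_poly res C) (map_poly res D)) addrC addKr.
exists Q, (C - Q * D); split; last by rewrite addrC subrK.
apply/eqP/negPn/negP=> nzR.
have [|] := leqP (size (map_poly res D)) (size (map_poly res (C - Q * D))).
  by rewrite DR leqNgt ltn_modp nzD.
rewrite ltnNge minD //; split=> //; rewrite rmorphB rmorphM /=.
apply: rpredD => //; rewrite -mulNr; apply: vint_vmaxM => //.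
by rewrite rpredN vring_eval_vint.
Qed.

Lemma simple_root_descent P : ev P = 0 -> ev P^`() \notin vmax w ->
  exists2 Q0, ev Q0 \notin vmax w & forall C, ev C \in vmax w ->
    exists2 T, map_poly res T = 0 & ev T = ev Q0 * ev C.
Proof.
move=> Pz P'z; have [D Dz divD] := vmax_eval_principal.
have [|Q0 [T0 [T0_0 DP]]] := divD P; first by rewrite Pz inE eqxx.
exists Q0 => [|C /divD[Q [T [T_0 DC]]]].
  apply: contra P'z => Q0z; rewrite DP derivD derivM rmorphD rmorphD !rmorphM.
  apply: rpredD; last by apply: vring_eval_vmax; rewrite -deriv_map T0_0 deriv0.
  apply: rpredD; first by apply: vint_vmaxM (vring_eval_vint _) Dz.
  by rewrite mulrC; apply: vint_vmaxM (vring_eval_vint _) Q0z.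
exists (Q0 * T - Q * T0); first by rewrite rmorphB !rmorphM /= T_0 T0_0 !mulr0 subrr.
have -> : Q0 * T - Q * T0 = Q0 * C - Q * P by rewrite DC DP; ring.
by rewrite rmorphB !rmorphM Pz mulr0 subr0.
Qed.

Lemma eval_primitive_part (C : {poly E}) : (map_poly j C).[z] != 0 ->
  exists i C0, [/\ C`_i != 0, ev C0 != 0 & w (map_poly j C).[z] = w (j C`_i) + w (ev C0)].
Proof.
move=> nzCz; have nzC : C != 0 by apply: contraNneq nzCz => ->; rewrite rmorph0 horner0.
have [i [C0 [nzi DC]]] := vring_primitive_part wE nzC.
have DCz : (map_poly j C).[z] = j C`_i * ev C0.
  by rewrite {1}DC map_polyZ hornerZ vring_evalE.
have nzC0 : ev C0 != 0 by move: nzCz; rewrite DCz mulf_eq0 => /norP[].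
by exists i, C0; rewrite DCz valuationM ?fmorph_eq0.
Qed.

Lemma simple_root_integral_value P C :
    ev P = 0 -> ev P^`() \notin vmax w -> ev C != 0 ->
  exists2 a, a != 0 & w (j a) = w (ev C).
Proof.
move=> Pz P'z; have [Q0 Q0z descent] := simple_root_descent Pz P'z.
have [nzQ0 wQ0] := vint_Nvmax (vring_eval_vint Q0) Q0z.
have w_ge0 C1 : ev C1 != 0 -> 0 <= w (ev C1).
  by move/negPf=> nzC1; have := vring_eval_vint C1; rewrite inE nzC1.
have [n] := ubnP `|w (ev C)|%N; elim: n C => // n IHn C ltCn nzC.
have [Cz|Cz] := boolP (ev C \in vmax w); last first.
  exists 1; rewrite ?oner_eq0 // rmorph1 valuation1.
  by have [_ ->] := vint_Nvmax (vring_eval_vint C) Cz.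
have [T T_0 DT] := descent C Cz; have nzT : ev T != 0 by rewrite DT mulf_neq0.
rewrite vring_evalE in nzT; have [i [C0 [nzTi nzC0 wT]]] := eval_primitive_part nzT.
have wTi : 0 < w (j (map_poly val T)`_i).
  have := res_eq0 T`_i; rewrite -coef_map T_0 coef0 eqxx coef_map inE.
  by move: nzTi; rewrite coef_map => /negPf-> /esym.
have wC : w (ev C) = w (j (map_poly val T)`_i) + w (ev C0).
  by rewrite -wT -vring_evalE DT valuationM // wQ0 add0r.
have [|//|b nzb wb] := IHn C0.
  by move: (w_ge0 C0 nzC0) wTi wC ltCn; clear; lia.
exists ((map_poly val T)`_i * b); first by rewrite mulf_neq0.
by rewrite rmorphM valuationM ?fmorph_eq0 // wC wb.
Qed.

Lemma simple_root_value P (C : {poly E}) :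
    ev P = 0 -> ev P^`() \notin vmax w -> (map_poly j C).[z] != 0 ->
  exists2 a, a != 0 & w (j a) = w (map_poly j C).[z].
Proof.
move=> Pz P'z /eval_primitive_part[i [C0 [nzi nzC0 ->]]].
have [b nzb <-] := simple_root_integral_value Pz P'z nzC0.
exists (C`_i * b); first by rewrite mulf_neq0.
by rewrite rmorphM valuationM ?fmorph_eq0.
Qed.

End SimpleRoot.

Lemma simple_root_value_group (E L : fieldType) (j : {rmorphism E -> L}) (w : valuation L)
    (P C : {poly E}) (z : L) :
    z \in vint w -> map_poly j P \is a polyOver (vint w) -> root (map_poly j P) z ->
    (map_poly j P)^`().[z] \notin vmax w -> (map_poly j C).[z] != 0 ->
  exists2 a, a != 0 & w (j a) = w (map_poly j C).[z].
Proof.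
move=> Oz OP Pz P'z nzCz.
have [kappa [res [res_eq0 res_onto]]] := residue_field_exists (restrict_valuation j w).
have [|P0 DP] := @polyOver_vintP _ (restrict_valuation j w) P.
  apply/polyOverP=> i; have /polyOverP/(_ i) := OP.
  by rewrite coef_map !inE /= fmorph_eq0.
apply: (simple_root_value res_eq0 res_onto Oz (P := P0)) => //.
  by rewrite vring_evalE DP (rootP Pz).
by rewrite vring_evalE -deriv_map DP -deriv_map.
Qed.

Lemma value_group_adjoin_simple_roots (K : fieldType) (L : fieldExtType K) (w : valuation L)
    (E : {subfield L}) (P : {poly L}) (zs : seq L) :
    P \is a polyOver E -> P \is a polyOver (vint w) ->
    (forall z, z \in zs -> [/\ z \in vint w, root P z & P^`().[z] \notin vmax w]) ->
  forall y, y \in <<E & zs>>%VS -> y != 0 -> exists2 a, a \in E & (a != 0) && (w a == w y).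
Proof.
elim: zs E => [|z zs IHzs] E EP OP simple_zs y.
  by rewrite Fadjoin_nil => Ey nzy; exists y; rewrite ?nzy ?eqxx.
rewrite adjoin_cons => Ey nzy.
have [||a /Fadjoin_polyP[C EC Da] /andP[nza /eqP wa]] := IHzs <<E; z>>%AS _ OP _ y Ey nzy.
- by apply/polyOverP=> i; apply/subvP_adjoin/polyOverP.
- by move=> z' zs_z'; apply: simple_zs; rewrite inE zs_z' orbT.
have [Oz Pz P'z] := simple_zs z (mem_head _ _).
have /polyOver_subvs[P0 DP] := EP; have /polyOver_subvs[C0 DC] := EC.
have := @simple_root_value_group _ L (vsval : subvs_of E -> L) w P0 C0 z.
rewrite -DP -DC -Da => /(_ Oz OP Pz P'z nza)[c nzc wc].
by exists (vsval c); rewrite ?subvsP // fmorph_eq0 nzc wc wa eqxx.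
Qed.

(** * Reduction of a split polynomial *)

Definition wronskian (R : comNzRingType) (P Q : {poly R}) := P^`() * Q - P * Q^`().

Lemma map_wronskian (R S : comNzRingType) (f : {rmorphism R -> S}) (P Q : {poly R}) :
  map_poly f (wronskian P Q) = wronskian (map_poly f P) (map_poly f Q).
Proof. by rewrite rmorphB !rmorphM /= -!deriv_map. Qed.

Lemma wronskian_pencil_l (R : comNzRingType) (P Q : {poly R}) t :
  wronskian (P - t *: Q) Q = wronskian P Q.
Proof. by rewrite /wronskian derivB derivZ -!mul_polyC; ring. Qed.

Lemma wronskian_pencil_r (R : comNzRingType) (P Q : {poly R}) t :
  wronskian (P - t *: Q) P = t *: wronskian P Q.
Proof. by rewrite /wronskian derivB derivZ -!mul_polyC; ring. Qed.

Lemma dvdp_exp_wronskian (K : fieldType) (P y : {poly K}) z n :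
  ('X - z%:P) ^+ n.+1 %| P -> ('X - z%:P) ^+ n %| wronskian P y.
Proof.
move=> /dvdpP[Q ->]; rewrite /wronskian derivM deriv_exp derivXsubC mul1r exprS.
apply/dvdpP; exists ((Q^`() * ('X - z%:P) + Q *+ n.+1) * y - Q * ('X - z%:P) * y^`()).
by rewrite -mulr_natr -[Q *+ _]mulr_natr; ring.
Qed.

Lemma root_wronskian_collision (K : fieldType) (I : finType) (x : I -> K) (y : {poly K}) i k :
  i != k -> x i = x k -> root (wronskian (\prod_i ('X - (x i)%:P)) y) (x i).
Proof.
move=> neq_ik eq_ik; rewrite -dvdp_XsubCl -[_ - _]expr1; apply: dvdp_exp_wronskian.
rewrite (bigD1 i) // (bigD1 k) 1?eq_sym //= -eq_ik mulrA -expr2.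
exact: dvdp_mulIl.
Qed.

Lemma count_leq_undup (T : eqType) (a : pred T) (s : seq T) m :
  (forall x, count_mem x s <= m)%N -> (count a s <= size (undup (filter a s)) * m)%N.
Proof.
move=> le_m; rewrite -size_filter; set t := filter a s.
rewrite -(perm_size (perm_count_undup t)) size_flatten /shape -map_comp sumnE big_map.
apply: (@leq_trans (\sum_(x <- undup t) m)%N).
  apply: leq_sum => x _; rewrite /= size_nseq; apply: leq_trans (le_m x).
  by rewrite count_filter; apply: sub_count => y /andP[].
by rewrite big_const_seq count_predT iter_addn_0 mulnC.
Qed.

Lemma count_critical_roots (K : fieldType) (P y : {poly K}) c (s : seq K) (W := wronskian P y) :
    c != 0 -> P = c *: \prod_(z <- s) ('X - z%:P) -> W != 0 ->
  (count (root W) s <= (size W).-1 * size W)%N.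
Proof.
move=> nzc DP nzW; have leW z : (count_mem z s <= size W)%N.
  case Ds: (count_mem z s) => [|n] //; rewrite -(size_exp_XsubC n z) dvdp_leq //.
  apply: dvdp_exp_wronskian; rewrite DP dvdpZr // -mup_geq ?mu_prod_XsubC ?Ds //.
  by rewrite monic_neq0 ?monic_prod_XsubC.
apply: leq_trans (count_leq_undup _ leW) _; set t := undup _.
have lt_t : (size t < size W)%N.
  apply: max_poly_roots; rewrite ?undup_uniq //.
  by apply/allP=> z; rewrite mem_undup mem_filter => /andP[].
by rewrite leq_mul2r -ltnS (ltn_predK lt_t) lt_t orbT.
Qed.

Section Reduction.

Variables (L kappa : fieldType) (w : valuation L) (res : {rmorphism vring w -> kappa}).
Hypothesis res_eq0 : forall a, (res a == 0) = (val a \in vmax w).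

Definition residue (x : L) : kappa := res (insubd 0 x).

Lemma residue_val a : residue (val a) = res a.
Proof. by rewrite /residue valKd. Qed.

Lemma residue_eq0 x : x \in vint w -> (residue x == 0) = (x \in vmax w).
Proof. by move=> Ox; rewrite res_eq0 insubdK. Qed.

Lemma vring_horner (P : {poly vring w}) x : x \in vint w -> (map_poly val P).[x] \in vint w.
Proof.
move=> Ox; rewrite -[x](insubdK (0 : vring w) Ox) horner_map.
exact: vring_valP.
Qed.

Lemma residue_horner (P : {poly vring w}) x : x \in vint w ->
  residue (map_poly val P).[x] = (map_poly res P).[residue x].
Proof.
move=> Ox; rewrite -{1}(insubdK 0 Ox : val (insubd 0 x : vring w) = x).
by rewrite horner_map residue_val horner_map.
Qed.

Lemma split_poly_lift (xs : seq L) : exists b (S : {poly vring w}),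
  \prod_(x <- xs) ('X - x%:P) = b *: map_poly val S
  /\ map_poly res S = \prod_(x <- xs | x \in vint w) ('X - (residue x)%:P).
Proof.
pose lift x : vring w := insubd 0 x.
exists (\prod_(x <- xs | x \notin vint w) (- x)).
exists (\prod_(x <- xs | x \notin vint w) (1 - lift x^-1 *: 'X)
        * \prod_(x <- xs | x \in vint w) ('X - (lift x)%:P)); split; last first.
  rewrite rmorphM !rmorph_prod /= big1 ?mul1r => [|x nOx].
    by apply: eq_bigr => x _; rewrite rmorphB /= map_polyX map_polyC.
  rewrite rmorphB rmorph1 /= map_polyZ.
  have /eqP : residue x^-1 == 0 by rewrite residue_eq0 ?vmax_vint ?vmaxV.
  by rewrite /residue => ->; rewrite scale0r subr0.
rewrite (bigID (mem (vint w))) /= mulrC rmorphM scalerAl /=; congr (_ * _); last first.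
  rewrite rmorph_prod; apply: eq_bigr => x Ox.
  by rewrite rmorphB /= map_polyX map_polyC /= insubdK.
rewrite rmorph_prod -scaler_prod; apply: eq_bigr => x nOx.
rewrite rmorphB rmorph1 /= map_polyZ map_polyX /= insubdK ?vmax_vint ?vmaxV //.
rewrite scalerBr scalerA mulNr mulfV ?scaleN1r ?opprK ?alg_polyC ?polyCN 1?addrC //.
by apply: contraNneq nOx => ->; rewrite inE eqxx.
Qed.

(* The reduction of S is monic, so a * b is the quotient of a coefficient of P by a unit. *)
Lemma reduction_split (P : {poly vring w}) a (xs : seq L) :
    map_poly val P = a *: \prod_(x <- xs) ('X - x%:P) -> map_poly res P != 0 ->
  exists2 c, c != 0 &
    map_poly res P = c *: \prod_(x <- xs | x \in vint w) ('X - (residue x)%:P).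
Proof.
have [b [S [-> DS]]] := split_poly_lift xs; rewrite scalerA => DP nzP.
pose n := (size (map_poly res S)).-1; have Sn : val S`_n \notin vmax w.
  rewrite -res_eq0 -coef_map -lead_coefE DS (monicP _) ?oner_eq0 //.
  exact: monic_prod_XsubC.
have Oab : a * b \in vint w.
  have [nzSn _] := vint_Nvmax (valP S`_n) Sn.
  have -> : a * b = val P`_n * (val S`_n)^-1.
    by rewrite -[val P`_n]coef_map DP coefZ coef_map mulfK.
  by rewrite rpredM ?vintV ?vring_valP.
have DPS : P = insubd 0 (a * b) *: S.
  apply: (map_inj_poly (f := val)); [exact: val_inj | exact: rmorph0 |].
  by rewrite DP map_polyZ /= insubdK.
rewrite -DS; exists (residue (a * b)); last by rewrite DPS map_polyZ.
by apply: contraNneq nzP; rewrite /residue DPS map_polyZ => ->; rewrite scale0r.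
Qed.

Lemma count_ramified_roots_vring (P y : {poly vring w}) d a (xs : seq L) (W := wronskian P y) :
    map_poly val P = a *: \prod_(x <- xs) ('X - x%:P) -> (map_poly res P)`_d != 0 ->
    map_poly res W != 0 ->
  (count [pred x | (x \notin vint w) || ((map_poly val W).[x] \in vmax w)] xs + d
    <= size xs + (size W).-1 * size W)%N.
Proof.
move=> DP nzPd nzW.
have nzP : map_poly res P != 0 by apply: contraNneq nzPd => ->; rewrite coef0.
have [c nzc DPc] := reduction_split DP nzP.
pose s := [seq residue x | x <- xs & x \in vint w].
have {}DPc : map_poly res P = c *: \prod_(z <- s) ('X - z%:P).
  by rewrite DPc big_map big_filter.
have lt_d : (d <= count (mem (vint w)) xs)%N.
  rewrite -ltnS -(size_filter (mem (vint w))) -(size_map residue) -/s.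
  rewrite -(size_prod_XsubC s id) -(size_scale _ nzc) -DPc.
  by rewrite ltnNge; apply: contra nzPd => /leq_sizeP->.
have leW : (count (root (map_poly res W)) s <= (size W).-1 * size W)%N.
  rewrite map_wronskian in nzW *; apply: leq_trans (count_critical_roots nzc DPc nzW) _.
  rewrite -map_wronskian.
  have szW : (size (map_poly res W) <= size W)%N by apply: size_poly.
  by rewrite leq_mul // -!subn1 leq_sub2r.
have DcountW : count (root (map_poly res W)) s =
    count [pred x | (x \in vint w) && ((map_poly val W).[x] \in vmax w)] xs.
  rewrite count_map count_filter; apply: eq_count => x /=.
  rewrite andbC; case Ox: (x \in vint w) => //=.
  by rewrite rootE -residue_horner // residue_eq0 // vring_horner.
set bad := count _ xs; have Dsize := count_predC (mem (vint w)) xs.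
suff: (bad <= count (predC (mem (vint w))) xs + count (root (map_poly res W)) s)%N by lia.
rewrite DcountW -count_predUI; apply: leq_trans (leq_addr _ _); apply: sub_count => x /=.
by case: (x \in vint w).
Qed.

End Reduction.

Lemma count_ramified_roots (L : fieldType) (w : valuation L) (P y : {poly L}) d k a
    (xs : seq L) (W := wronskian P y) :
    P = a *: \prod_(x <- xs) ('X - x%:P) -> P \is a polyOver (vint w) -> P`_d \notin vmax w ->
    y \is a polyOver (vint w) -> W`_k \notin vmax w ->
  (count [pred x | (x \notin vint w) || (W.[x] \in vmax w)] xs + d
    <= size xs + (size W).-1 * size W)%N.
Proof.
move=> DP /polyOver_vintP[P0 EP] nMPd /polyOver_vintP[y0 Ey] nMWk.
have [kappa [res [res_eq0 _]]] := residue_field_exists w.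
have EW : W = map_poly val (wronskian P0 y0) by rewrite /W -EP -Ey map_wronskian.
have coef_res_neq0 (Q : {poly vring w}) i :
    (map_poly val Q)`_i \notin vmax w -> (map_poly res Q)`_i != 0.
  by rewrite !coef_map res_eq0.
have -> : size W = size (wronskian P0 y0).
  by rewrite EW size_map_inj_poly ?rmorph0 //; apply: val_inj.
rewrite EW; apply: (count_ramified_roots_vring res_eq0 (P := P0) (a := a)).
- by rewrite EP.
- by apply: coef_res_neq0; rewrite EP.
have := coef_res_neq0 (wronskian P0 y0) k; rewrite -EW => /(_ nMWk).
by apply: contraNneq => ->; rewrite coef0.
Qed.

(** * A rational function with few critical points *)

(* The cover t = g/h; the bounds by b limit the ramification over t = oo, where h has
   degree less than g, and over finite t. *)
Record double_zero_cover (F : fieldType) (b : nat) (g h v : {poly F}) : Prop := {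
  cover_monic : g \is monic;
  cover_size_lt : (size h < size g)%N;
  cover_size_le : (size g <= size h + b)%N;
  cover_coprime : coprimep g h;
  cover_double_zero : g = 'X^2 * v;
  cover_wronskian_neq0 : wronskian g h != 0;
  cover_wronskian_size : ((size (wronskian g h)).-1 * size (wronskian g h) <= b)%N;
  cover_wronskian_coprime : coprimep v (wronskian g h) }.

Section CoverData.

Variables (F : fieldType) (b : nat) (g h v : {poly F}).
Hypothesis cov : double_zero_cover b g h v.

Lemma cover_num0 : g.[0] = 0.
Proof. by rewrite (cover_double_zero cov) hornerM hornerXn expr0n mul0r. Qed.

Lemma cover_den0 : h.[0] != 0.
Proof.
apply/eqP=> h0; have /coprimep_root/(_ (introT eqP cover_num0)) := cover_coprime cov.
by rewrite h0 eqxx.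
Qed.

Lemma cover_cofactor0 : v.[0] != 0.
Proof.
apply/eqP=> v0; have /coprimep_root/(_ (introT eqP v0)) := cover_wronskian_coprime cov.
rewrite /wronskian hornerD hornerN !hornerM cover_num0 mul0r subr0 (cover_double_zero cov).
by rewrite derivM derivXn !hornerE expr0n !mul0r eqxx.
Qed.

End CoverData.

Lemma deriv_expM_pchar (R : comNzRingType) p (q : {poly R}) n :
  p \in [pchar R] -> (q ^+ (p * n))^`() = 0.
Proof.
move=> charRp.
by rewrite deriv_exp mulrnA -[_ *+ p]mulr_natr -polyC_natr (pcharf0 charRp) mulr0 mul0rn.
Qed.

(* D is the derivative of u, scaled to be monic. Since D^p and 'X^(p * e) have derivative
   0, g/h = D^p + u/h has the same derivative as 1/('X^(p * e) + 1/u): its critical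
   points are the zeros of u'. The factor 'X of D makes 0 a double zero of g, alone in
   its fibre because D vanishes at the other critical points and u does not. The leading
   term of D^p reduces the ramification at infinity to the degree of D^p. *)
Section CoverConstruction.

Variables (p : nat) (F : fieldType) (u1 : {poly F}) (k e : nat).
Hypothesis charFp : p \in [pchar F].
Hypotheses (mon_u1 : u1 \is monic) (sep_u1 : separable_poly u1) (nz_u1_0 : u1.[0] != 0).
Hypotheses (sz_u1 : size u1 = k.+1) (nz_deg : k.+2%:R != 0 :> F) (ltkp : (k < p)%N).

Let u := 'X^2 * u1.
Let D1 := k.+2%:R^-1 *: (2%:R *: u1 + 'X * u1^`()).
Let D := 'X * D1.
Let h := 1 + u * 'X^(p * e).
Let g := D ^+ p * h + u.
Let v := u1 + 'X^(p - 2) * D1 ^+ p * h.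

Let pr_p : prime p := pcharf_prime charFp.

Let deriv_u : u^`() = k.+2%:R *: D.
Proof.
rewrite /D /D1 -scalerAr scalerA mulfV // scale1r /u derivM derivXn expr1 mulrDr.
by rewrite -scaler_nat -scalerAr -scalerAl mulrA -expr2.
Qed.

Let D1_monic_size : D1 \is monic /\ size D1 = k.+1.
Proof.
pose Q := 2%:R *: u1 + 'X * u1^`(); have leQ : (size Q <= k.+1)%N.
  apply: leq_trans (size_polyD _ _) _; rewrite geq_max -sz_u1 size_scale_leq /=.
  have [->|nzu'] := eqVneq u1^`() 0; first by rewrite mulr0 size_poly0.
  by rewrite mulrC size_mulX // lt_size_deriv ?monic_neq0.
have Qk : Q`_k = k.+2%:R.
  have u1k : u1`_k = 1 by have := monicP mon_u1; rewrite lead_coefE sz_u1.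
  rewrite coefD coefZ coefXM coef_deriv u1k mulr1; case: (k) u1k => [|k'] u1k /=.
    by rewrite addr0.
  by rewrite u1k -natrD.
have szQ : size Q = k.+1.
  apply/eqP; rewrite eqn_leq leQ ltnNge; apply: contra nz_deg => /leq_sizeP/(_ k (leqnn k)).
  by rewrite Qk => ->.
rewrite /D1 -/Q size_scale ?invr_eq0 // monicE lead_coefZ lead_coefE szQ Qk.
by rewrite mulVf.
Qed.

Let u_h_monic_size : [/\ u \is monic, size u = k.+3, h \is monic & size h = (k.+3 + p * e)%N].
Proof.
have mon_u : u \is monic by rewrite rpredM ?monicXn.
have sz_u : size u = k.+3.
  by rewrite size_monicM ?monicXn ?monic_neq0 // size_polyXn sz_u1.
have sz_uX : size (u * 'X^(p * e)) = (k.+3 + p * e)%N.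
  by rewrite size_monicM ?expf_neq0 ?polyX_eq0 // size_polyXn sz_u addnS.
have lt1 : (size (1%R : {poly F}) < size (u * 'X^(p * e))%R)%N by rewrite size_poly1 sz_uX.
split=> //; rewrite /h addrC ?size_polyDl // monicE lead_coefDl //.
by rewrite lead_coef_Mmonic ?monicXn // -monicE.
Qed.

Let g_size_monic : size g = (p * k.+1 + k.+3 + p * e)%N /\ g \is monic.
Proof.
have [monu szu monh szh] := u_h_monic_size; have [monD1 szD1] := D1_monic_size.
have monD : D \is monic by rewrite rpredM ?monicX.
have szD : size D = k.+2 by rewrite /D mulrC size_mulX ?monic_neq0 // szD1.
have szDp : size (D ^+ p) = (p * k.+1).+1.
  by rewrite -[LHS]prednK ?size_exp ?szD 1?mulnC // size_poly_gt0 monic_neq0 ?monic_exp.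
have szDh : size (D ^+ p * h) = (p * k.+1 + k.+3 + p * e)%N.
  by rewrite size_monicM ?monic_exp ?monic_neq0 // szDp szh addSn /= addnA.
have lt_u : (size u < size (D ^+ p * h)%R)%N.
  by rewrite szDh szu addnAC -[ltnLHS]add0n ltn_add2r addn_gt0 muln_gt0 prime_gt0.
rewrite /g size_polyDl // monicE lead_coefDl // -monicE.
by rewrite rpredM ?monic_exp.
Qed.

Let wronskianE : wronskian g h = k.+2%:R *: D.
Proof.
have dh : h^`() = u^`() * 'X^(p * e).
  by rewrite derivD derivC add0r derivM deriv_expM_pchar // mulr0 addr0.
have dg : g^`() = D ^+ p * h^`() + u^`().
  by rewrite derivD derivM -[X in D ^+ X]muln1 deriv_expM_pchar // mul0r add0r.
rewrite /wronskian dg dh -deriv_u.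
have -> : (D ^+ p * (u^`() * 'X^(p * e)) + u^`()) * h - g * (u^`() * 'X^(p * e))
  = u^`() * (h - u * 'X^(p * e)) by rewrite /g; ring.
by rewrite /h addrK mulr1.
Qed.

Let double_zero : g = 'X^2 * v.
Proof.
rewrite /g /v /u /D exprMn -[in 'X^p](subnKC (prime_gt1 pr_p)) exprD.
set A := 'X^(p - 2); set B := D1 ^+ p; ring.
Qed.

Let coprime_num_den : coprimep g h.
Proof.
apply/Bezout_eq1_coprimepP; exists (- 'X^(p * e), 1 + 'X^(p * e) * D ^+ p) => /=.
have -> : - 'X^(p * e) * g + (1 + 'X^(p * e) * D ^+ p) * h = h - u * 'X^(p * e).
  by rewrite /g; ring.
by rewrite /h addrK.
Qed.

Let v_neq0 : v.[0] != 0.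
Proof.
rewrite /v hornerD !hornerM hornerXn horner_exp.
suff -> : 0 ^+ (p - 2) * D1.[0] ^+ p = 0 by rewrite mul0r addr0.
have [p2|p2] := eqVneq p 2%N; last first.
  by rewrite expr0n subn_eq0 leqNgt ltn_neqAle eq_sym p2 prime_gt1 ?mul0r.
have two0 : 2%:R = 0 :> F by rewrite -p2 (pcharf0 charFp).
rewrite /D1 !(hornerZ, hornerD, hornerM) hornerX two0 !mul0r addr0 mulr0.
by rewrite [X in _ * X]expr0n gtn_eqF ?mulr0 ?prime_gt0.
Qed.

Let coprime_v_D : coprimep v D.
Proof.
have coprime_X q : q.[0] != 0 -> coprimep q 'X.
  by rewrite -['X]subr0 -polyC0 coprimep_XsubC rootE.
have coprime_u1_D1 : coprimep u1 D1.
  rewrite coprimepZr ?invr_eq0 // -mul_polyC coprimep_addl_mul coprimepMr coprime_X //.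
  by have := sep_u1; rewrite separable_poly.unlock.
rewrite coprimepMr coprime_X //=.
have -> : v = 'X^(p - 2) * D1 ^+ p.-1 * h * D1 + u1.
  rewrite /v (_ : D1 ^+ p = D1 ^+ p.-1 * D1); last by rewrite -exprSr prednK ?prime_gt0.
  by set A := 'X^(p - 2); set B := D1 ^+ _; ring.
by rewrite coprimep_sym coprimep_addl_mul coprimep_sym.
Qed.

Lemma separable_double_zero_cover :
  double_zero_cover (p ^ 2 + p) g h v /\ size g = (p * k.+1 + k.+3 + p * e)%N.
Proof.
have [_ _ _ szh] := u_h_monic_size; have [szg mong] := g_size_monic.
have [monD1 szD1] := D1_monic_size.
have szD : size D = k.+2 by rewrite /D mulrC size_mulX ?monic_neq0 // szD1.
have pk_gt0 : (0 < p * k.+1)%N by rewrite muln_gt0 prime_gt0.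
split=> //; split; rewrite ?szg ?szh ?wronskianE ?size_scale ?szD //=.
- by rewrite -addnA -[ltnLHS]add0n ltn_add2r.
- by rewrite -addnA addnC leq_add2l (leq_trans _ (leq_addr _ _)) // -mulnn leq_mul2l ltkp orbT.
- by rewrite scaler_eq0 negb_or nz_deg -size_poly_eq0 szD.
- by rewrite -mulnn addnC -mulnS leq_mul.
- by rewrite coprimepZr.
Qed.

End CoverConstruction.

Lemma separable_poly_exists (F : fieldType) k : k = 0 \/ k%:R != 0 :> F ->
  exists2 u : {poly F}, [/\ u \is monic, separable_poly u & u.[0] != 0] & size u = k.+1.
Proof.
rewrite separable_poly.unlock => nzk; case: (posnP k) nzk => [-> _|k_gt0 [k0|nzk]].
- by exists 1; rewrite ?size_poly1 ?rpred1 ?coprime1p ?hornerE ?oner_eq0.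
- by rewrite k0 in k_gt0.
have lt1 : (size (1%R : {poly F}) < size ('X^k : {poly F})%R)%N by rewrite size_poly1 size_polyXn.
exists ('X^k + 1); last by rewrite size_polyDl // size_polyXn.
split; first by rewrite monicE lead_coefDl // lead_coefXn.
  rewrite derivD derivC addr0 derivXn -scaler_nat coprimepZr //.
  have -> : 'X^k + 1 = 'X * 'X^(k.-1) + 1 :> {poly F} by rewrite -exprS prednK.
  by rewrite coprimep_sym coprimep_addl_mul coprimep1.
by rewrite !hornerE ?hornerXn expr0n gtn_eqF // add0r oner_eq0.
Qed.

Lemma double_zero_cover_exists (p : nat) (F : fieldType) m :
    p \in [pchar F] -> ~~ (p %| m)%N -> (3 * p ^ 2 <= m)%N ->
  exists g h v : {poly F}, double_zero_cover (p ^ 2 + p) g h v /\ size g = m.+1.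
Proof.
move=> charFp ndvd_pm le_m; have p_gt1 := prime_gt1 (pcharf_prime charFp).
pose k := ((m + (p - 2)) %% p)%N; have ltkp : (k < p)%N by rewrite ltn_mod ltnW.
have k2m : k.+2 = m %[mod p].
  by rewrite -addn2 /k modnDml -addnA subnK // modnDr.
have [|u [mon_u sep_u u0] szu] := @separable_poly_exists F k.
  have [->|k_gt0] := posnP k; [by left | right].
  by rewrite -(dvdn_pcharf charFp) gtnNdvd.
have [e De] : exists e, m = (p * k.+1 + k.+2 + p * e)%N.
  have /eqP := k2m; rewrite eq_sym eqn_mod_dvd; last by nia.
  case/dvdnP=> q Dq; exists (q - k.+1)%N.
  have : (k.+1 <= q)%N by nia.
  by nia.
have [|cover Dsize] := separable_double_zero_cover e charFp mon_u sep_u u0 szu _ ltkp.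
  by rewrite -(dvdn_pcharf charFp) /dvdn k2m.
do 3 eexists; split; first exact: cover.
by rewrite Dsize De addnS.
Qed.

(** * Permutation groups *)

Section PermutationGroups.

Local Open Scope group_scope.

Lemma perm_group_full_tperm (T : finType) (D : {group {perm T}}) a :
  (forall y, tperm a y \in D) -> D :=: [set: {perm T}].
Proof.
move=> Da; apply/eqP; rewrite eqEsubset subsetT /= -(gen_tperm a) gen_subG.
by apply/subsetP=> _ /imsetP[y _ ->].
Qed.

Lemma tperm_rel_trans (T : finType) (D : {group {perm T}}) :
  transitive (fun x y => tperm x y \in D).
Proof.
move=> y x z Dxy Dyz; have [->|neq_xz] := eqVneq x z; first by rewrite tperm1.
have [<-|neq_yz] := eqVneq y z; first by [].
by rewrite -(tpermJ_tperm neq_yz neq_xz) groupJ // tpermC.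
Qed.

(* D permutes transitively the classes of the equivalence relation tperm x y \in D, so
   their common cardinality divides #|T|. *)
Lemma transitive_tperm_full (T : finType) (D : {group {perm T}}) a b :
    prime #|T| -> (forall x y, exists2 s, s \in D & s x = y) ->
    a != b -> tperm a b \in D -> D :=: [set: {perm T}].
Proof.
move=> prT trD neq_ab Dab; pose R : rel T := fun x y => tperm x y \in D.
have eqR : {in [set: T] & &, equivalence_rel R}.
  move=> x y z _ _ _; split=> [|Rxy]; first by rewrite /R tperm1 group1.
  by apply/idP/idP; apply: tperm_rel_trans; rewrite // tpermC.
pose class x := [set z in setT | R x z].
have le_class x y : (#|class x| <= #|class y|)%N.
  have [s Ds <-] := trD x y; rewrite -(card_imset _ (@perm_inj _ s)).
  apply/subset_leq_card/subsetP=> _ /imsetP[z + ->]; rewrite !inE /= => Rxz.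
  by rewrite /R -tpermJ groupJ.
have card_class : {in equivalence_partition R setT, forall A : {set T}, #|A| = #|class a|}.
  by move=> _ /imsetP[x _ ->]; apply/eqP; rewrite eqn_leq !le_class.
have := card_uniform_partition card_class (equivalence_partitionP eqR); rewrite cardsT => DT.
have dvd_class : (#|class a| %| #|T|)%N by rewrite DT dvdn_mull.
have class_gt1 : (1 < #|class a|)%N.
  by apply/card_gt1P; exists a, b; split=> //; rewrite !inE /R ?tperm1 ?group1.
have full_class : class a = setT.
  apply/eqP; rewrite eqEcard subsetT cardsT /=.
  by case/primeP: prT => _ /(_ _ dvd_class)/pred2P[class1|->] //; rewrite class1 in class_gt1.
apply: (perm_group_full_tperm (a := a)) => y.
by have /setIdP[] : y \in class a by rewrite full_class inE.
Qed.

Lemma tperm_conj_full (T : finType) (B : {group {perm T}}) a b :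
  a != b -> (forall s, tperm a b ^ s \in B) -> B :=: [set: {perm T}].
Proof.
move=> neq_ab Bab; apply: (perm_group_full_tperm (a := a)) => y.
have [->|neq_ya] := eqVneq y a; first by rewrite tperm1 group1.
by have := Bab (tperm b y); rewrite tpermJ tpermL tpermD // eq_sym.
Qed.

Lemma perm_on_card2 (T : finType) (A : {set T}) (s : {perm T}) :
  #|A| = 2%N -> perm_on A s -> s != 1 -> exists a b, a != b /\ s = tperm a b.
Proof.
move=> /eqP/cards2P[a [b [neq_ab ->]]] onA nt_s; exists a, b; split=> //.
have sa : s a \in [set a; b] by rewrite perm_closed // set21.
have sb : s b \in [set a; b] by rewrite perm_closed // set22.
have fix_out i : i != a -> i != b -> s i = i.
  by move=> na nb; apply: (out_perm onA); rewrite !inE negb_or na.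
case/set2P: sa sb => sa /set2P[] sb.
- by case/eqP: neq_ab; apply: (@perm_inj _ s); rewrite sa sb.
- case/eqP: nt_s; apply/permP=> i; rewrite perm1.
  by have [->//|na] := eqVneq i a; have [->//|nb] := eqVneq i b; apply: fix_out.
- by apply/permP=> i; case: tpermP => [->//|->//|/eqP na /eqP nb]; apply: fix_out.
- by case/eqP: neq_ab; apply: (@perm_inj _ s); rewrite sa sb.
Qed.

Section Copies.

Variables T U V : finType.

Definition copies_fun (s : {perm T}) (i : T * U + V) : T * U + V :=
  match i with inl (a, b) => inl (s a, b) | inr c => inr c end.

Fact copies_fun_inj s : injective (copies_fun s).
Proof.
by apply: (can_inj (g := copies_fun s^-1)) => -[[a b]|c] //=; rewrite permK.
Qed.

Definition copies_perm s : {perm (T * U + V)} := perm (@copies_fun_inj s).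

Fact copies_permM : {morph copies_perm : s t / s * t}.
Proof. by move=> s t; apply/permP=> -[[a b]|c]; rewrite permM !permE //= permM. Qed.

Canonical copies_morphism := Morphism (in2W copies_permM : {in setT &, _}).

Lemma card_copies_moved s : s != 1 -> (#|U| <= #|[set i | copies_perm s i != i]|)%N.
Proof.
move=> nt_s; have [a sa] : exists a, s a != a.
  apply/existsP; apply: contraNT nt_s; rewrite negb_exists => /forallP fix_s.
  by apply/eqP/permP=> a; rewrite perm1; apply/eqP; rewrite -[_ == _]negbK.
have inj_b : injective (fun b : U => inl (a, b) : T * U + V) by move=> b c [].
rewrite -cardsT -(card_imset _ inj_b); apply/subset_leq_card/subsetP=> _ /imsetP[b _ ->].
by rewrite inE permE /=; apply: contra sa => /eqP[->].
Qed.

Lemma injm_copies : (0 < #|U|)%N -> 'injm copies_morphism.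
Proof.
move=> U_gt0; apply/subsetP=> s /morphpreP[_ /set1P s1]; rewrite inE.
apply: contraLR U_gt0 => /card_copies_moved; rewrite -leqNgt [copies_perm s]s1.
by rewrite (_ : [set _ | _] = set0) ?cards0 //; apply/setP=> i; rewrite !inE perm1 eqxx.
Qed.

End Copies.

End PermutationGroups.

Section RootPermutation.

Variables (K : fieldType) (L : splittingFieldType K) (I : finType) (x : I -> L).
Hypotheses (inj_x : injective x) (gen_x : <<1 & codom x>>%VS = {:L}%VS).
Hypothesis stable_x : forall (s : gal_of {:L}) i, s (x i) \in codom x.

Fact gal_perm_subproof (s : gal_of {:L}) : injective (fun i => iinv (stable_x s i)).
Proof.
by move=> i k /(congr1 x); rewrite !f_iinv => /fmorph_inj/inj_x.
Qed.

Definition gal_perm s : {perm I} := perm (@gal_perm_subproof s).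

Lemma gal_permE s i : x (gal_perm s i) = s (x i).
Proof. by rewrite permE f_iinv. Qed.

Lemma gal_permM : {morph gal_perm : s t / (s * t)%g}.
Proof.
move=> s t; apply/permP=> i; apply: inj_x.
by rewrite permM !gal_permE galM ?memvf.
Qed.

Canonical gal_perm_morphism := Morphism (in2W gal_permM : {in setT &, _}).

Lemma gal_fix_generators (s : gal_of {:L}) : (forall i, s (x i) = x i) -> s = 1%g.
Proof.
move=> fix_s; apply/eqP/gal_eqP=> y _; rewrite gal_id.
have /subvP/(_ y) : (<<1 & codom x>> <= fixedField [set s])%VS.
  apply/Fadjoin_seqP; split=> [|_ /codomP[i ->]]; first exact: sub1v.
  by apply/fixedFieldP=> [|u /set1P->]; [apply: memvf | ].
by rewrite gen_x memvf => /(_ isT)/fixedFieldP/(_ s (set11 s)); apply; apply: memvf.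
Qed.

Lemma injm_gal_perm : ('injm gal_perm_morphism)%g.
Proof.
apply/subsetP=> s /morphpreP[_ /set1P s1]; apply/set1P/gal_fix_generators => i.
by rewrite -gal_permE [gal_perm s]s1 perm1.
Qed.

End RootPermutation.

(** * Splitting fields *)

Lemma irreducible_factor (F : fieldType) (p : {poly F}) :
  (1 < size p)%N -> exists2 r, irreducible_poly r & r %| p.
Proof.
move=> szp; have [r [szr dv_r] min_r] := exists_minimal
  (P := fun r : {poly F} => (1 < size r)%N /\ r %| p) (fun r => size r) (conj szp (dvdpp p)).
exists r => //; split=> // q szq dv_q; have nzr : r != 0 by rewrite -size_poly_gt0 ltnW.
have nzq : q != 0 by apply: contraNneq nzr => q0; rewrite -dvd0p -q0.
rewrite -dvdp_size_eqp // eqn_leq dvdp_leq // min_r //; split.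
  by move: szq nzq; rewrite -size_poly_gt0; case: (size q) => [|[]].
exact: dvdp_trans dv_q dv_r.
Qed.

Lemma splitting_extension (F : fieldType) (p : {poly F}) : p != 0 ->
  exists (L : fieldExtType F) (zs : seq L),
    map_poly (in_alg L) p %= \prod_(z <- zs) ('X - z%:P).
Proof.
have [n] := ubnP (size p); elim: n F p => // n IHn F p ltpn nzp.
have [szp|szp] := leqP (size p) 1.
  exists F^o, [::]; rewrite big_nil -size_poly_eq1 size_map_poly.
  by rewrite eqn_leq szp size_poly_gt0.
have [r irr_r dv_r] := irreducible_factor szp.
have [K _ [x rx0 _]] := irredp_FAdjoin irr_r.
have /factor_theorem[q Dp] : root (map_poly (in_alg K) p) x.
  by rewrite -(divpK dv_r) rmorphM rootM rx0 orbT.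
have nzq : q != 0.
  have := nzp; rewrite -(map_poly_eq0 (in_alg K)) Dp mulf_eq0 negb_or.
  by case/andP.
have ltq : (size q < n)%N.
  have := size_map_poly (in_alg K) p; rewrite Dp size_mul ?polyXsubC_eq0 //.
  by rewrite size_XsubC addn2 /= => Esz; rewrite -ltnS Esz.
have [L [zs Dq]] := IHn K q ltq nzq.
exists (baseFieldType L), (x%:A :: zs).
rewrite big_cons -(eq_map_poly (fun a : F => baseField_scaleE a 1)).
suff : map_poly (in_alg L) (map_poly (in_alg K) p)
    %= ('X - (x%:A)%:P) * \prod_(z <- zs) ('X - z%:P).
  by rewrite -map_poly_comp.
by rewrite Dp rmorphM /= rmorphB /= map_polyX map_polyC mulrC eqp_mull.
Qed.

Lemma splittingFieldFor_subvs (F : fieldType) (L : fieldExtType F) (p : {poly F}) (ys : seq L)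
    (E := <<1 & ys>>%AS) :
    map_poly (in_alg L) p %= \prod_(y <- ys) ('X - y%:P) ->
  splittingFieldFor 1 (map_poly (in_alg (subvs_of E)) p) {:subvs_of E}.
Proof.
move=> Dp; pose toL := linfun (vsval : subvs_of E -> L); pose zs := map (vsproj E) ys.
have Dys : map toL zs = ys.
  rewrite -map_comp map_id_in // => y ys_y.
  by rewrite /= lfunE /= vsprojK ?seqv_sub_adjoin.
exists zs.
  rewrite -(eqp_map toL) -map_poly_comp (eq_map_poly (g := in_alg L)) => [|c]; last first.
    exact: rmorph_alg.
  apply: eqp_trans Dp _; rewrite -{1}Dys big_map rmorph_prod.
  rewrite (eq_bigr (fun z => map_poly toL ('X - z%:P))) ?eqpxx // => z _.
  by rewrite rmorphB /= map_polyX map_polyC.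
apply/vspaceP=> u; rewrite memvf.
have : toL u \in (toL @: <<1 & zs>>)%VS.
  by rewrite aimg_adjoin_seq aimg1 Dys lfunE /= (valP u).
by case/memv_imgP=> v Ev; rewrite !lfunE /= => /val_inj->.
Qed.

Lemma splitting_field_exists (F : fieldType) (p : {poly F}) : p != 0 ->
  exists L : splittingFieldType F, splittingFieldFor 1 (map_poly (in_alg L) p) {:L}.
Proof.
move=> /splitting_extension[L [ys /splittingFieldFor_subvs split_p]].
pose E := <<1 & ys>>%AS; have ax : SplittingField.axiom (subvs_of E).
  exists (map_poly (in_alg (subvs_of E)) p) => //.
  by apply/polyOverP=> i; rewrite coef_map /= rpredZ ?mem1v.
pose S : splittingFieldType F :=
  HB.pack (subvs_of E) (FieldExt_isSplittingField.Build F (subvs_of E) ax).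
by exists S.
Qed.

Lemma monic_map_split (R : comNzRingType) (F : fieldType) (f : {rmorphism R -> F})
    (P : {poly R}) :
  P \is monic -> exists (K : fieldType) (iota : {rmorphism F -> K}) (ys : seq K),
    map_poly (iota \o f) P = \prod_(y <- ys) ('X - y%:P) /\ size P = (size ys).+1.
Proof.
move=> monP; have monfP : map_poly f P \is monic by rewrite monic_map.
have [K [ys Dys _]] := splitting_field_exists (monic_neq0 monfP).
have DP : map_poly (in_alg K \o f) P = \prod_(y <- ys) ('X - y%:P).
  rewrite map_poly_comp; apply/eqP.
  by rewrite -eqp_monic ?monic_map // monic_prod_XsubC.
exists K, (in_alg K), ys; split=> //; rewrite -(size_prod_XsubC ys id) -DP.
by rewrite size_map_poly_id0 // (monicP monP) rmorph1 oner_eq0.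
Qed.

(** * Rational functions *)

Section RationalFunctions.

Variable F : fieldType.

Local Notation "x %:F" := (@FracField.tofrac _ x) : ring_scope.

Lemma fraction_coprime (a : ratfun F) : exists n d : {poly F},
  [/\ d != 0, coprimep n d & a * d%:F = n%:F].
Proof.
have [n [d [nzd Da]]] : exists n d : {poly F}, d != 0 /\ a * d%:F = n%:F.
  elim/quotW: a => x; exists \n_x, \d_x; split; first exact: denom_ratioP.
  unlock FracField.tofrac; rewrite -[LHS]FracField.pi_mul.
  apply/eqmodP=> /=; rewrite FracField.equivfE /FracField.mulf.
  by rewrite !numden_Ratio ?mulr1 ?oner_eq0 ?denom_ratioP // mulrC.
have nzg : gcdp n d != 0 by rewrite gcdp_eq0 negb_and nzd orbT.
exists (n %/ gcdp n d), (d %/ gcdp n d); split.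
- by rewrite dvdp_div_eq0 ?dvdp_gcdr.
- by rewrite coprimep_div_gcd // nzd orbT.
- apply: (mulIf (x := (gcdp n d)%:F)); first by rewrite tofrac_eq0.
  by rewrite -mulrA -!tofracM !divpK ?dvdp_gcdl ?dvdp_gcdr.
Qed.

Lemma monic_root_denominator_dvd (P : {poly {poly F}}) (a : ratfun F) (n d : {poly F}) :
    P \is monic -> root (map_poly (@FracField.tofrac _) P) a -> a * d%:F = n%:F ->
  d %| n ^+ (size P).-1.
Proof.
move=> monP Pa Da; set k := (size P).-1.
have szP : size P = k.+1 by rewrite prednK // size_poly_gt0 monic_neq0.
have Pk : P`_k = 1 by move/monicP: monP; rewrite lead_coefE.
suff -> : n ^+ k = - d * \sum_(i < k) P`_i * n ^+ i * d ^+ (k - i.+1).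
  by rewrite mulNr dvdpNr dvdp_mulr.
apply/eqP; rewrite -subr_eq0 mulNr opprK -(tofrac_eq0 (_ + _)).
rewrite tofracD tofracM tofracXn raddf_sum /= mulr_sumr.
have /eqP := Pa; rewrite horner_coef size_map_poly_id0; last first.
  by rewrite (monicP monP) tofrac1 oner_eq0.
rewrite szP big_ord_recr /= coef_map /= Pk tofrac1 mul1r addrC.
move/(congr1 (fun z => z * d%:F ^+ k)); rewrite mul0r mulrDl -exprMn Da => {2}<-.
rewrite mulr_suml; apply/eqP; congr (_ + _); apply: eq_bigr => i _.
rewrite coef_map /= -mulrA !tofracM !tofracXn -Da exprMn.
have -> : d%:F ^+ k = d%:F ^+ i * (d%:F * d%:F ^+ (k - i.+1)).
  by rewrite -exprS -exprD; congr (_ ^+ _); have := ltn_ord i; lia.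
by ring.
Qed.

Lemma polynomials_integrally_closed (a : ratfun F) :
  integralOver (@FracField.tofrac {poly F}) a -> exists q, a = q%:F.
Proof.
move=> [P monP Pa]; have [n [d [nzd cop_nd Da]]] := fraction_coprime a.
have dv_d : d %| 1.
  have cop_dn : coprimep d (n ^+ (size P).-1) by rewrite coprimep_sym coprimep_expl.
  by rewrite -(Gauss_dvdpl 1 cop_dn) mul1r (monic_root_denominator_dvd monP Pa Da).
have /size_poly1P[c nzc Dd] : size d == 1%N by rewrite -dvdp1.
exists (c^-1 *: n); have nzcF : c%:P%:F != 0 :> ratfun F by rewrite tofrac_eq0 polyC_eq0.
apply: (mulIf nzcF); rewrite -Dd Da Dd -tofracM mulrC mul_polyC scalerA.
by rewrite mulfV // scale1r.
Qed.

Variable L : fieldExtType (ratfun F).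

Definition polyL (q : {poly F}) : L := (@FracField.tofrac {poly F} q)%:A.

HB.instance Definition _ := GRing.RMorphism.copy polyL
  (in_alg L \o @FracField.tofrac {poly F}).

HB.instance Definition _ := GRing.RMorphism.copy (@constF F L)
  (polyL \o polyC).

Lemma polyL_eq0 q : (polyL q == 0) = (q == 0).
Proof. by rewrite -[polyL q]/(in_alg L q%:F) fmorph_eq0 tofrac_eq0. Qed.

Lemma polyL_inj : injective polyL.
Proof.
move=> q r eq_qr; apply/eqP; rewrite -subr_eq0 -polyL_eq0 rmorphB /= eq_qr.
by rewrite subrr.
Qed.

Lemma polyL_mem1 q : polyL q \in 1%VS.
Proof. by rewrite rpredZ ?mem1v. Qed.

Lemma integral_mem1 (y : L) : integralOver polyL y -> y \in 1%VS ->
  exists q, y = polyL q.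
Proof.
case=> P monP Py /vlineP[a Dy].
have [|q Da] := @polynomials_integrally_closed a; last by exists q; rewrite Dy Da.
exists P => //; move: Py; rewrite Dy (map_poly_comp (in_alg L)).
by rewrite fmorph_root.
Qed.

Lemma integral_const_poly (y : L) : algebraicOver (@constF F L) y -> integralOver polyL y.
Proof.
move/integral_algebraic => [q mon_q qy]; exists (map_poly polyC q).
  by rewrite monic_map.
by rewrite -map_poly_comp.
Qed.

Lemma algebraic_polyL q : algebraicOver (@constF F L) (polyL q) -> exists c, q = c%:P.
Proof.
case=> r nzr; rewrite (eq_map_poly (g := polyL \o polyC)) // map_poly_comp.
rewrite /root horner_map polyL_eq0 -[_.[q]]/(r \Po q) => /eqP rq0.
have [szq|szq] := leqP (size q) 1; first by exists q`_0; apply: size1_polyC.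
have /eqP : ((size r).-1 * (size q).-1 = 0)%N by rewrite -size_comp_poly rq0 size_poly0.
rewrite muln_eq0 -!subn1 !subn_eq0 (leqNgt (size q)) szq orbF => szr.
move: rq0; rewrite (size1_polyC szr) comp_polyC => /eqP.
by rewrite polyC_eq0 -polyC_eq0 -size1_polyC // (negPf nzr).
Qed.

Lemma constant_mem1 (y : L) : algebraicOver (@constF F L) y -> y \in 1%VS ->
  exists c, y = constF L c.
Proof.
move=> alg_y y1; have [q Dy] := integral_mem1 (integral_const_poly alg_y) y1.
by rewrite Dy in alg_y *; have [c ->] := algebraic_polyL alg_y; exists c.
Qed.

End RationalFunctions.

(** * Specialization of roots *)

Section SymmetricSpecialization.

Lemma rmorph_mmap n (R : nzRingType) (A B : comNzRingType) (psi : {rmorphism A -> B})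
    (f : {rmorphism R -> A}) (h : 'I_n -> A) (p : {mpoly R[n]}) :
  psi (mmap f h p) = mmap (psi \o f) (psi \o h) p.
Proof.
rewrite /mmap rmorph_sum /=; apply: eq_bigr => m _; rewrite rmorphM /mmap1.
by rewrite rmorph_prod; congr (_ * _); apply: eq_bigr => i _; rewrite rmorphXn.
Qed.

Lemma eq_mmap n (R A : nzRingType) (f g : R -> A) (h k : 'I_n -> A) (p : {mpoly R[n]}) :
  f =1 g -> h =1 k -> mmap f h p = mmap g k p.
Proof.
move=> eq_fg eq_hk; apply: eq_bigr => m _; rewrite eq_fg /mmap1.
by congr (_ * _); apply: eq_bigr => i _; rewrite eq_hk.
Qed.

Lemma mmap_msym n (R A : comNzRingType) (f : {rmorphism R -> A}) (h : 'I_n -> A)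
    (s : 'S_n) (p : {mpoly R[n]}) :
  mmap f h (msym s p) = mmap f (h \o s) p.
Proof.
rewrite /msym (rmorph_mmap (mmap f h)).
by apply: eq_mmap => [a|i] /=; rewrite ?mmapC // mmapX mmap1U.
Qed.

Lemma mmap_mesym n (R : comNzRingType) (A : idomainType) (f : {rmorphism R -> A})
    (cs : n.-tuple A) (P : {poly R}) (k : nat) : (k <= n)%N ->
    map_poly f P = \prod_(c <- cs) ('X - c%:P) ->
  mmap f (tnth cs) (mesym n R k) = f ((-1) ^+ k * P`_(n - k)).
Proof.
move=> lekn DP; have := mroots_coeff cs (Ordinal (lekn : k < n.+1)%N) => /=.
rewrite -DP coef_map rmorphM /= => ->; rewrite rmorphXn rmorphN1 mulrA -exprMn mulrNN.
rewrite mulr1 expr1n mul1r /mesym !rmorph_sum /=; apply: eq_bigr => i _.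
by rewrite !rmorph_prod /=; apply: eq_bigr => j _; rewrite mmapX mmap1U mevalXU.
Qed.

Lemma symmetric_specialization n (R : comNzRingType) (A B : idomainType)
    (f : {rmorphism R -> A}) (g : {rmorphism R -> B})
    (cs : n.-tuple A) (ds : n.-tuple B) (P : {poly R}) (S : {mpoly R[n]}) :
    map_poly f P = \prod_(c <- cs) ('X - c%:P) ->
    map_poly g P = \prod_(d <- ds) ('X - d%:P) -> S \is symmetric ->
  exists r, mmap f (tnth cs) S = f r /\ mmap g (tnth ds) S = g r.
Proof.
move=> Df Dg /sym_fundamental[t [<- _]].
pose e (i : 'I_n) := (-1) ^+ i.+1 * P`_(n - i.+1).
have eval_elementary (C : idomainType) (h : {rmorphism R -> C}) (bs : n.-tuple C) :
    map_poly h P = \prod_(b <- bs) ('X - b%:P) ->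
    mmap h (tnth bs) (t \mPo [tuple mesym n R i.+1 | i < n]) = h (mmap idfun e t).
  move=> Dh; rewrite /comp_mpoly (rmorph_mmap (mmap h (tnth bs))).
  rewrite (rmorph_mmap h); apply: eq_mmap => [a|i] /=; first by rewrite mmapC.
  by rewrite tnth_mktuple (mmap_mesym _ Dh).
by exists (mmap idfun e t); rewrite !eval_elementary.
Qed.

Lemma specialize_relation n (R A B : idomainType)
    (f : {rmorphism R -> A}) (g : {rmorphism R -> B})
    (cs : n.-tuple A) (ds : n.-tuple B) (P : {poly R}) (Q : {mpoly R[n]}) :
    injective f -> map_poly f P = \prod_(c <- cs) ('X - c%:P) ->
    map_poly g P = \prod_(d <- ds) ('X - d%:P) -> mmap f (tnth cs) Q = 0 ->
  exists s : 'S_n, mmap g (tnth ds \o s) Q = 0.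
Proof.
move=> inj_f Df Dg Q0; pose S := \prod_(s : 'S_n) msym s Q.
have symS : S \is symmetric.
  apply/issymP=> s; rewrite /S rmorph_prod /= [RHS](reindex_inj (mulIg s)) /=.
  by apply: eq_bigr => t _; rewrite msymMm.
have [r [Dr Er]] := symmetric_specialization Df Dg symS.
have r0 : r = 0.
  by apply: inj_f; rewrite -Dr rmorph_prod (bigD1 1%g) //= msym1m Q0 mul0r rmorph0.
move: Er; rewrite r0 rmorph0 rmorph_prod => /eqP/prodf_eq0[s _ /eqP].
by rewrite /= mmap_msym; exists s.
Qed.

(* Apply the previous lemma over R[Y] to the combination of the relations Q s
   with the coefficients Y^(rank s). *)
Lemma specialize_relations n (R A B : idomainType)
    (f : {rmorphism R -> A}) (g : {rmorphism R -> B})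
    (cs : n.-tuple A) (ds : n.-tuple B) (P : {poly R}) (Q : 'S_n -> {mpoly R[n]}) :
    injective f -> map_poly f P = \prod_(c <- cs) ('X - c%:P) ->
    map_poly g P = \prod_(d <- ds) ('X - d%:P) -> (forall s, mmap f (tnth cs) (Q s) = 0) ->
  exists s : 'S_n, mmap g (tnth ds \o s) (Q s) = 0.
Proof.
move=> inj_f Df Dg Q0; pose QY : {mpoly {poly R}[n]} :=
  \sum_(s : 'S_n) ('X^(enum_rank s))%:MP * map_mpoly polyC (Q s).
have evQY (C : idomainType) (h : {rmorphism R -> C}) (c : 'I_n -> C) :
    mmap (map_poly h) (polyC \o c) QY = \sum_s mmap h c (Q s) *: 'X^(enum_rank s).
  rewrite /QY rmorph_sum /=; apply: eq_bigr => s _.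
  rewrite rmorphM /= mmapC /= rmorphXn /= map_polyX mulrC -mul_polyC; congr (_ * _).
  rewrite /map_mpoly (rmorph_mmap (mmap (map_poly h) (polyC \o c))).
  rewrite (rmorph_mmap (@polyC C)); apply: eq_mmap => [a|i] /=.
    by rewrite mmapC /= map_polyC.
  by rewrite mmapX mmap1U.
have tnthC (C : idomainType) (bs : n.-tuple C) :
    tnth [tuple of map polyC bs] =1 polyC \o tnth bs by move=> i; rewrite tnth_map.
have splitY (C : idomainType) (h : {rmorphism R -> C}) (bs : n.-tuple C) :
    map_poly h P = \prod_(b <- bs) ('X - b%:P) ->
    map_poly (map_poly h) (map_poly polyC P) = \prod_(b <- map polyC bs) ('X - b%:P).
  move=> Dh; rewrite -map_poly_comp (eq_map_poly (g := polyC \o h)) => [|a /=]; last first.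
    by rewrite map_polyC.
  rewrite big_map map_poly_comp Dh rmorph_prod /=; apply: eq_bigr => b _.
  by rewrite rmorphB /= map_polyX map_polyC.
have [||s] := specialize_relation (Q := QY) _ (splitY _ _ _ Df) (splitY _ _ _ Dg).
- by apply: map_inj_poly; rewrite ?rmorph0.
- by rewrite (eq_mmap _ (fun=> erefl) (tnthC _ cs)) evQY big1 // => s _; rewrite Q0 scale0r.
rewrite (eq_mmap _ (fun=> erefl) (k := polyC \o (tnth ds \o s))) => [|i /=]; last first.
  by rewrite tnthC.
rewrite evQY => /(congr1 (fun q : {poly B} => q`_(enum_rank s))).
rewrite coef0 coef_sum (bigD1 s) //= coefZ coefXn eqxx mulr1 big1 ?addr0; first by exists s.
move=> t neq_ts; rewrite coefZ coefXn [_ == _ :> nat]negbTE ?mulr0 //.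
by apply: contraNneq neq_ts => /ord_inj/enum_rank_inj->.
Qed.

Lemma specialize_roots n (R A B : idomainType)
    (f : {rmorphism R -> A}) (g : {rmorphism R -> B})
    (cs : n.-tuple A) (ds : n.-tuple B) (P : {poly R}) :
    injective f -> map_poly f P = \prod_(c <- cs) ('X - c%:P) ->
    map_poly g P = \prod_(d <- ds) ('X - d%:P) ->
  exists s : 'S_n, forall Q, mmap f (tnth cs) Q = 0 -> mmap g (tnth ds \o s) Q = 0.
Proof.
move=> inj_f Df Dg; apply: NNPP => no_s.
have /fin_all_exists2[Q Q0 Qnz] (s : 'S_n) : exists2 Q,
    mmap f (tnth cs) Q = 0 & mmap g (tnth ds \o s) Q <> 0.
  apply: NNPP => noQ; apply: no_s; exists s => Q fQ0; apply: NNPP => gQ.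
  by apply: noQ; exists Q.
by have [s /Qnz] := specialize_relations inj_f Df Dg Q0.
Qed.

End SymmetricSpecialization.

(** * Galois conjugates *)

Lemma mem_gal1 (K : fieldType) (L : splittingFieldType K) (s : gal_of {:L}) :
  s \in 'Gal({:L} / 1)%g.
Proof. by rewrite gal_kHom ?sub1v // k1AHom. Qed.

Lemma mem_gal_adjoin (K : fieldType) (M : splittingFieldType K) (s : gal_of {:M}) y :
  (s \in 'Gal({:M} / <<1; y>>)%g) = (s y == y).
Proof.
rewrite -sub1set galois_connection ?subvf //; apply/FadjoinP/eqP => [[_]|sy].
  by case/mem_fixedFieldP=> _; apply; rewrite inE.
split; first exact: sub1v.
by apply/fixedFieldP=> [|u]; [apply: memvf | rewrite inE => /eqP->].
Qed.

Lemma integral_coef_prod_XsubC (R : comNzRingType) (K : fieldType) (f : {rmorphism R -> K})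
    (I : Type) (r : seq I) (A : pred I) (x : I -> K) :
    (forall i, A i -> integralOver f (x i)) ->
  forall k, integralOver f (\prod_(i <- r | A i) ('X - (x i)%:P))`_k.
Proof.
move=> int_x; elim/big_rec: _ => [|i P Ai intP] k; first by rewrite coef1; apply: integral_nat.
rewrite mulrBl coefB coefXM coefCM; apply: integral_sub.
  by case: ifP => // _; apply: integral0.
by apply: integral_mul => //; apply: int_x.
Qed.

Lemma integral_mmap (R : comNzRingType) (K : fieldType) (f : {rmorphism R -> K}) n
    (h : 'I_n -> K) (Q : {mpoly R[n]}) :
  (forall i, integralOver f (h i)) -> integralOver f (mmap f h Q).
Proof.
move=> int_h; rewrite /mmap; elim/big_ind: _ => [|x y|m _].
- exact: integral0.
- exact: integral_add.
apply: integral_mul; first exact: integral_id.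
rewrite /mmap1; elim/big_ind: _ => [|x y|i _]; [exact: integral1 | exact: integral_mul |].
elim: (m i) => [|k IHk]; first exact: integral1.
by rewrite exprS; apply: integral_mul.
Qed.

Section GaloisConjugates.

Variables (F : fieldType) (L : splittingFieldType (ratfun F)).
Hypothesis galL : galois 1 {:L}.
Local Notation integral := (integralOver (@polyL F L)).
Implicit Type s : gal_of {:L}.

Lemma gal_fixed_mem1 (y : L) : (forall s, s y = y) -> y \in 1%VS.
Proof.
move=> fix_y; have /galois_fixedField<- := galL.
by apply/fixedFieldP => //; apply: memvf.
Qed.

Lemma gal_polyL s q : s (polyL L q) = polyL L q.
Proof. by rewrite linearZ rmorph1. Qed.

Lemma gal_map_polyL s (P : {poly {poly F}}) :
  map_poly s (map_poly (@polyL F L) P) = map_poly (@polyL F L) P.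
Proof. by apply/polyP=> i; rewrite !coef_map /= gal_polyL. Qed.

Lemma gal_map_constF s (q : {poly F}) :
  map_poly s (map_poly (@constF F L) q) = map_poly (@constF F L) q.
Proof. by apply/polyP=> i; rewrite !coef_map /= gal_polyL. Qed.

Lemma gal_algebraic s y : algebraicOver (@constF F L) y -> algebraicOver (@constF F L) (s y).
Proof. by move=> [q nzq qy]; exists q => //; rewrite -(gal_map_constF s) rmorph_root. Qed.

Lemma gal_integral s y : integral y -> integral (s y).
Proof. by move=> [P monP Py]; exists P => //; rewrite -(gal_map_polyL s) rmorph_root. Qed.

Lemma invariant_integral_poly (P : {poly L}) :
    (forall s, map_poly s P = P) -> (forall k, integral P`_k) ->
  exists P0 : {poly {poly F}}, map_poly (@polyL F L) P0 = P.
Proof.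
move=> fixP intP; apply: map_poly_lift => i.
have [||q ->] := @integral_mem1 F L P`_i; [exact: intP | | by exists q].
by apply: gal_fixed_mem1 => s; rewrite -coef_map fixP.
Qed.

Lemma conjugates_poly (zs : seq L) : (forall z, z \in zs -> integral z) ->
  exists (xs : seq L) (P : {poly {poly F}}),
    [/\ {subset zs <= xs}, forall s x, x \in xs -> s x \in xs,
        P \is monic & map_poly (@polyL F L) P = \prod_(x <- xs) ('X - x%:P)].
Proof.
move=> int_zs; pose xs := [seq (s : gal_of {:L}) z | z <- zs, s <- enum {: gal_of {:L}}].
pose fx := \prod_(x <- xs) ('X - x%:P).
have int_xs x : x \in xs -> integral x.
  by case/allpairsP=> [[z s]] /= [zs_z _ ->]; apply/gal_integral/int_zs.
have fix_fx s : map_poly s fx = fx.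
  rewrite /fx /xs !big_allpairs_dep rmorph_prod /=; apply: eq_bigr => z _.
  rewrite rmorph_prod /= !big_enum /= [RHS](reindex_inj (mulIg s)) /=.
  by apply: eq_bigr => u _; rewrite rmorphB /= map_polyX map_polyC /= galM ?memvf.
have int_fx k : integral fx`_k.
  by rewrite /fx big_seq; apply: integral_coef_prod_XsubC.
have [P DP] := invariant_integral_poly fix_fx int_fx; exists xs, P; split=> //.
- by move=> z zs_z; apply/allpairsP; exists (z, 1%g); rewrite mem_enum gal_id.
- move=> s x /allpairsP[[z u] /= [zs_z _ ->]]; apply/allpairsP; exists (z, (u * s)%g) => /=.
  by rewrite mem_enum galM ?memvf.
have := monic_prod_XsubC xs xpredT id; rewrite -/fx -DP !monicE.
rewrite lead_coef_map_inj ?rmorph0 //; last exact: polyL_inj.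
by move/eqP=> E; apply/eqP/(@polyL_inj F L); rewrite E rmorph1.
Qed.

End GaloisConjugates.

(** * Places over t = 0 *)

(* A place is the residue map of a Galois-stable ring of integral elements of L, which
   place_ring presents: place_val need not be injective. *)
Record place (F : fieldType) (L : splittingFieldType (ratfun F)) := Place {
  place_ring : comNzRingType;
  place_field : fieldType;
  place_poly : {rmorphism {poly F} -> place_ring};
  place_val : {rmorphism place_ring -> L};
  place_res : {rmorphism place_ring -> place_field};
  place_ker : forall a, place_val a = 0 -> place_res a = 0;
  place_polyE : forall q, place_val (place_poly q) = polyL L q;
  place_resX : place_res (place_poly 'X) = 0;
  place_integral : forall a, integralOver (@polyL F L) (place_val a);
  place_gal : forall (s : gal_of {:L}) a, exists b, place_val b = s (place_val a) }.

Definition inertial (F : fieldType) (L : splittingFieldType (ratfun F)) (pl : place L)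
    (s : gal_of {:L}) :=
  forall a b : place_ring pl, place_val pl b = s (place_val pl a) ->
    place_res pl b = place_res pl a.

Lemma place_of_split_poly (F : fieldType) (L : splittingFieldType (ratfun F)) n
    (xs : n.-tuple L) (P : {poly {poly F}}) :
    P \is monic -> map_poly (@polyL F L) P = \prod_(x <- xs) ('X - x%:P) ->
    (forall (s : gal_of {:L}) x, x \in xs -> s x \in xs) ->
  exists pl : place L, forall x, x \in xs -> exists a, place_val pl a = x.
Proof.
move=> monP DP gal_xs; pose A := {mpoly {poly F}[n]}.
have [K [iota [ys [DPK sz_ys]]]] := monic_map_split (horner_eval 0) monP.
have sz_ys_n : size ys == n.
  rewrite -eqSS -sz_ys -(size_map_inj_poly (@polyL_inj F L)) ?rmorph0 // DP.
  by rewrite (size_prod_XsubC xs id) size_tuple.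
have [s res_ker] := specialize_roots (ds := Tuple sz_ys_n) (@polyL_inj F L) DP DPK.
pose ev : {rmorphism A -> L} := mmap (@polyL F L) (tnth xs).
pose res : {rmorphism A -> K} := mmap (iota \o horner_eval 0) (tnth (Tuple sz_ys_n) \o s).
pose const : {rmorphism {poly F} -> A} := @mpolyC n {poly F}.
have ev_const q : ev (const q) = polyL L q by rewrite /= mmapC.
have ev_X i : ev 'X_i = tnth xs i by rewrite /= mmapX mmap1U.
have resX : res (const 'X) = 0 by rewrite /= mmapC /= /horner_eval hornerX rmorph0.
have ev_integral Q : integralOver (@polyL F L) (ev Q).
  by apply: integral_mmap => i; exists P; rewrite // DP root_prod_XsubC mem_tnth.
have ev_gal (u : gal_of {:L}) Q : exists R, ev R = u (ev Q).
  have /fin_all_exists[v Dv] i : exists j, u (tnth xs i) = tnth xs j.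
    by apply/tnthP/gal_xs/mem_tnth.
  exists (mmap (@mpolyC _ _) (fun i => 'X_(v i)) Q).
  rewrite [LHS](rmorph_mmap ev) (rmorph_mmap u); apply: eq_mmap => [a|i] /=.
    by rewrite mmapC gal_polyL.
  by rewrite mmapX mmap1U Dv.
exists (Place res_ker ev_const resX ev_integral ev_gal) => x /tnthP[i ->].
by exists 'X_i.
Qed.

Lemma place_exists (F : fieldType) (L : splittingFieldType (ratfun F)) (zs : seq L) :
    galois 1 {:L} -> (forall z, z \in zs -> integralOver (@polyL F L) z) ->
  exists pl : place L, forall z, z \in zs -> exists a, place_val pl a = z.
Proof.
move=> galL /(conjugates_poly galL)[xs [P [sub_zs gal_xs monP DP]]].
have [pl pl_xs] := place_of_split_poly (xs := in_tuple xs) monP DP gal_xs.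
by exists pl => z /sub_zs/pl_xs.
Qed.

Section Inertia.

Variables (F : fieldType) (L : splittingFieldType (ratfun F)) (pl : place L).
Local Notation ev := (place_val pl).
Local Notation res := (place_res pl).
Local Notation const := (place_poly pl).
Implicit Types (s u : gal_of {:L}) (a b c : place_ring pl).

Lemma place_res_eq a b : ev a = ev b -> res a = res b.
Proof.
by move=> eq_ab; apply/eqP; rewrite -subr_eq0 -rmorphB place_ker // rmorphB eq_ab subrr.
Qed.

Lemma place_res_map_poly_eq (P Q : {poly place_ring pl}) :
  map_poly ev P = map_poly ev Q -> map_poly res P = map_poly res Q.
Proof.
by move=> eqPQ; apply/polyP=> i; rewrite !coef_map; apply: place_res_eq; rewrite -!coef_map eqPQ.
Qed.

Lemma place_res_polyC (q : {poly F}) : res (const q) = res (const (q.[0])%:P).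
Proof.
have /factor_theorem[r] : root (q - (q.[0])%:P) 0 by rewrite /root !hornerE subrr.
rewrite subr0 => /(canRL (subrK _))->.
by rewrite !rmorphD !rmorphM place_resX mulr0 add0r !hornerE ?mulr0 ?add0r.
Qed.

Lemma place_res_poly_eq0 (q : {poly F}) : (res (const q) == 0) = (q.[0] == 0).
Proof.
rewrite place_res_polyC; have [->|nzq0] := eqVneq q.[0] 0; first by rewrite !rmorph0 eqxx.
apply/eqP=> q0; have := rmorph1 (res \o const); rewrite -polyC1 -(mulVf nzq0) polyCM.
by rewrite rmorphM /= q0 mulr0 => /esym/eqP; rewrite oner_eq0.
Qed.

Definition place_const : {rmorphism F -> place_ring pl} := const \o polyC.

Lemma place_val_horner (q : {poly F}) a :
  ev (map_poly place_const q).[a] = (map_poly (@constF F L) q).[ev a].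
Proof.
rewrite -horner_map -map_poly_comp; congr (_.[_]).
by apply: eq_map_poly => c; rewrite /= place_polyE.
Qed.

Definition place_res_const : {rmorphism F -> place_field pl} := res \o place_const.

Lemma place_res_horner (q : {poly F}) a :
  res (map_poly place_const q).[a] = (map_poly place_res_const q).[res a].
Proof. by rewrite -horner_map -map_poly_comp. Qed.

(* If d = s y - y were a nonzero root of q, it would be a root of the quotient of q by
   its largest power of 'X; but d vanishes at the place and this quotient does not. *)
Lemma inertial_fix_algebraic s a :
  inertial pl s -> algebraicOver (@constF F L) (ev a) -> s (ev a) = ev a.
Proof.
move=> in_s alg_a; have [b Db] := place_gal s a.
have res_d : res (b - a) = 0 by rewrite rmorphB (in_s _ _ Db) subrr.
have alg_b : algebraicOver (@constF F L) (ev b) by rewrite Db; apply: gal_algebraic.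
have [q nzq] := algebraic_sub alg_b alg_a; rewrite -rmorphB /= -Db.
have [e [q1]] := multiplicity_XsubC q 0; rewrite nzq /= => q1_0 ->.
rewrite rmorphM rmorphXn /= subr0 map_polyX rootM => qd.
apply/eqP; rewrite -subr_eq0 -rmorphB; apply: contraTT qd => nzd.
rewrite negb_or /root hornerXn expf_eq0 (negPf nzd) andbF andbT -place_val_horner.
apply: contra q1_0 => /eqP/place_ker; rewrite place_res_horner res_d -{1}(rmorph0 place_res_const).
by rewrite horner_map => /eqP; rewrite fmorph_eq0.
Qed.

Lemma prodrD_sum_sets (R : comNzRingType) (I : finType) (x y : I -> R) :
  \prod_i (x i + y i) = \sum_(J : {set I}) (\prod_(i | i \notin J) y i) * \prod_(i in J) x i.
Proof.
rewrite bigA_distr; apply: eq_bigr => J _; rewrite mulrC [LHS](bigID (mem J)) /=.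
by congr (_ * _); apply: eq_bigr => i; [move=> -> | move=> /negPf->].
Qed.

(* The sum over J is the expansion of \prod_g (u (ev x_g) - g (ev x_g)), where the x_g
   show that g is not inertial. *)
Lemma separating_family : (forall s, s != 1%g -> ~ inertial pl s) ->
  exists (J : finType) (a b : J -> place_ring pl),
    (forall u, u != 1%g -> \sum_j ev (a j) * u (ev (b j)) = 0)
    /\ res (\sum_j a j * b j) != 0.
Proof.
move=> no_s; have /fin_all_exists2[x nzx Dx] (s : gal_of {:L}) : exists2 xy,
    res xy.1 != res xy.2 & (s != 1%g -> ev xy.2 = s (ev xy.1)).
  have [->|nt_s] := eqVneq s 1%g; first by exists (1, 0); rewrite ?rmorph0 ?rmorph1 ?oner_neq0.
  apply: NNPP => no_xy; apply: (no_s s nt_s) => a b Dab; apply: NNPP => /eqP neq_ba.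
  by apply: no_xy; exists (a, b); rewrite 1?eq_sym.
pose a (J : {set gal_of {:L}}) := \prod_(g | g \notin J) - (x g).2.
pose b (J : {set gal_of {:L}}) := \prod_(g in J) (x g).1.
exists {set gal_of {:L}}, a, b; split=> [u nt_u|].
  transitivity (\prod_g (u (ev (x g).1) + ev (- (x g).2))).
    by rewrite prodrD_sum_sets; apply: eq_bigr => J _; rewrite !rmorph_prod.
  by rewrite (bigD1 u) //= rmorphN Dx // subrr mul0r.
rewrite -(prodrD_sum_sets (fun g => (x g).1)) rmorph_prod.
by apply/prodf_neq0 => g _; rewrite rmorphB subr_eq0.
Qed.

Hypothesis galL : galois 1 {:L}.

Lemma trace_divisible y c : (forall s b, ev b = s (ev y) -> res b = 0) ->
  exists q, galTrace 1 {:L} (ev (c * y)) = polyL L ('X * q).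
Proof.
move=> y0; have [||r Dr] := @integral_mem1 F L (galTrace 1 {:L} (ev (c * y))).
- rewrite /galTrace; elim/big_ind: _ => [|a b|s _]; [exact: integral0 | exact: integral_add |].
  exact/gal_integral/place_integral.
- by apply: mem_galTrace; rewrite ?memvf.
have /fin_all_exists[d Dd] s : exists d, ev d = s (ev (c * y)) := place_gal s (c * y).
have /place_res_eq : ev (const r) = ev (\sum_(s : gal_of {:L}) d s).
  rewrite place_polyE -Dr rmorph_sum /galTrace; apply: eq_big => [s|s _]; first exact: mem_gal1.
  by rewrite Dd.
rewrite rmorph_sum big1 => [/eqP|s _]; last first.
  have [[c' Dc] [y' Dy]] := (place_gal s c, place_gal s y).
  rewrite (@place_res_eq _ (c' * y')) ?Dd ?rmorphM ?Dc ?Dy //.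
  by rewrite (y0 _ _ Dy) mulr0.
rewrite place_res_poly_eq0 => /factor_theorem[q Dq].
by exists q; rewrite Dr Dq subr0 mulrC.
Qed.

Lemma separated_trace (J : finType) (a b : J -> place_ring pl) y :
    (forall u, u != 1%g -> \sum_j ev (a j) * u (ev (b j)) = 0) ->
  ev (\sum_j a j * b j) * ev y = \sum_j ev (a j) * galTrace 1 {:L} (ev (b j * y)).
Proof.
move=> ab0; transitivity (\sum_(u : gal_of {:L}) (\sum_j ev (a j) * u (ev (b j))) * u (ev y)).
  rewrite (bigD1 1%g) //= gal_id [X in _ + X]big1 ?addr0 => [|u nt_u].
    by rewrite rmorph_sum; congr (_ * _); apply: eq_bigr => j _; rewrite rmorphM gal_id.
  by rewrite ab0 ?mul0r.
under eq_bigr => u _ do rewrite mulr_suml.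
rewrite exchange_big /=; apply: eq_bigr => j _; rewrite mulr_sumr.
apply: eq_big => [u|u _]; first by rewrite mem_gal1.
by rewrite !rmorphM mulrA.
Qed.

(* With a separating family, e := \sum_j a j * b j satisfies
   e y = \sum_j a j Tr(b j * y), which is divisible by t; as t h = x y, cancelling y
   shows that e h is a multiple of x, so that e or h vanishes at the place. *)
Lemma inertial_exists x y h :
    ev (const 'X * h) = ev (x * y) -> res h != 0 -> res x = 0 ->
    (forall s b, ev b = s (ev y) -> res b = 0) ->
  exists2 s, s != 1%g & inertial pl s.
Proof.
move=> Dth nzh x0 y0; apply: NNPP => no_s.
have [s nt_s in_s|J [a [b [ab0 nze]]]] := separating_family; first by apply: no_s; exists s.
have /fin_all_exists[q Dq] j := trace_divisible (b j) y0.
have De : ev (\sum_j a j * b j) * ev y = ev (const 'X * \sum_j a j * const (q j)).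
  rewrite (separated_trace _ ab0) mulr_sumr rmorph_sum; apply: eq_bigr => j _.
  by rewrite Dq !rmorphM !place_polyE; ring.
have nzt : ev (const 'X) != 0 by rewrite place_polyE polyL_eq0 polyX_eq0.
have nzy : ev y != 0.
  apply: contraNneq nzh => evy0; rewrite (@place_res_eq h 0) ?rmorph0 //.
  by apply: (mulfI nzt); rewrite -rmorphM Dth rmorphM evy0 !mulr0.
have /place_res_eq : ev ((\sum_j a j * b j) * h) = ev ((\sum_j a j * const (q j)) * x).
  apply: (mulIf nzy); rewrite !rmorphM mulrAC De.
  have := Dth; rewrite !rmorphM => Dth'; rewrite -[RHS]mulrA -Dth'; ring.
by rewrite !rmorphM x0 mulr0 => /eqP; rewrite mulf_eq0 (negPf nze) (negPf nzh).
Qed.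

End Inertia.

(** * The Galois group of the cover *)

Definition cover_poly (F : fieldType) (g h : {poly F}) : {poly {poly F}} :=
  g^:P - 'X *: h^:P.

Lemma coprime_pencil_irreducible (F : fieldType) (g h : {poly F}) (P Q : {poly {poly F}}) :
    coprimep g h -> g%:P - 'X * h%:P = P * Q ->
  (exists c, P = c%:P%:P) \/ (exists c, Q = c%:P%:P).
Proof.
move=> cgh; wlog le_PQ : P Q / (size P <= size Q)%N => [IH E|E].
  have [le_PQ|/ltnW le_QP] := leqP (size P) (size Q); first exact: IH.
  by have [] := IH Q P le_QP (etrans E (mulrC P Q)); [right | left].
have Dg : g = (P * Q)`_0 by rewrite -E coefB coefC coefXM subr0.
have Dh : h = - (P * Q)`_1 by rewrite -E coefB coefC coefXM coefC sub0r opprK.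
have nzPQ : P * Q != 0.
  apply/eqP=> PQ0; have := cgh; rewrite Dg Dh PQ0 !coef0.
  by rewrite oppr0 coprimep0 -size_poly_eq1 size_poly0.
have /negPf szP0 : P != 0 by apply: contraNneq nzPQ => ->; rewrite mul0r.
have nzQ : Q != 0 by apply: contraNneq nzPQ => ->; rewrite mulr0.
have : (size (P * Q)%R <= 2)%N.
  by apply/leq_sizeP=> -[|[|i]] // _; rewrite -E coefB coefC coefXM coefC subr0.
rewrite size_mul ?szP0 // => szPQ; left; have szP : (size P <= 1)%N.
  by move: (size P) (size Q) szPQ le_PQ => k l; lia.
have {szP szPQ le_PQ} DP := size1_polyC szP; rewrite DP in Dg Dh *.
have dvg : P`_0 %| g by rewrite Dg coefCM dvdp_mulr.
have dvh : P`_0 %| h by rewrite Dh coefCM dvdpNr dvdp_mulr.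
have : P`_0 %| 1.
  by apply: dvdp_trans (_ : gcdp g h %| 1); rewrite ?dvdp_gcd ?dvg // dvdp1 -coprimep_def.
by rewrite dvdp1 => /size_poly1P[c _ ->]; exists c.
Qed.

Lemma cover_poly_monic_size (F : fieldType) (b : nat) (g h v : {poly F}) :
    double_zero_cover b g h v ->
  cover_poly g h \is monic /\ size (cover_poly g h) = size g.
Proof.
move=> cov; have size_polyC_map (q : {poly F}) : size q^:P = size q.
  by rewrite (size_map_inj_poly (@polyC_inj _)) ?rmorph0.
have lt_hg : (size (- ('X *: h^:P)) < size g^:P)%N.
  rewrite size_polyN (leq_ltn_trans (size_scale_leq _ _)) // !size_polyC_map.
  exact: cover_size_lt cov.
rewrite /cover_poly size_polyDl // monicE lead_coefDl //.
by rewrite (lead_coef_map_inj (@polyC_inj _)) ?rmorph0 // (monicP (cover_monic cov)).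
Qed.

Section TheCover.

Variables (F : fieldType) (b : nat) (g h v : {poly F}).
Hypothesis cov : double_zero_cover b g h v.
Variables (L : splittingFieldType (ratfun F)) (I : finType) (x : I -> L).

Local Notation cL := (@constF F L).
Local Notation T := (polyL L 'X).
Local Notation gL := (map_poly cL g).
Local Notation hL := (map_poly cL h).
Local Notation WL := (map_poly cL (wronskian g h)).
Local Notation fL := (map_poly (@polyL F L) (cover_poly g h)).

Hypothesis fL_factor : fL = \prod_i ('X - (x i)%:P).
Hypothesis gen_x : <<1 & codom x>>%VS = {:L}%VS.

Lemma cover_polyE : fL = gL - T *: hL.
Proof. by rewrite rmorphB /= map_polyZ -!map_poly_comp. Qed.

Lemma wronskian_cover_den : wronskian fL hL = WL.
Proof. by rewrite cover_polyE wronskian_pencil_l map_wronskian. Qed.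

Lemma root_cover y : root fL y = (y \in codom x).
Proof.
by rewrite -root_prod_XsubC fL_factor big_image.
Qed.

Lemma root_cover_root i : root fL (x i).
Proof. by rewrite root_cover codom_f. Qed.

Lemma cover_root_equation i : T * hL.[x i] = gL.[x i].
Proof. by have := root_cover_root i; rewrite cover_polyE /root !hornerE subr_eq0 => /eqP->. Qed.

Lemma cover_root_den_neq0 i : hL.[x i] != 0.
Proof.
apply/eqP=> hx; have gx : root gL (x i) by rewrite /root -cover_root_equation hx mulr0.
have : coprimep gL hL by rewrite coprimep_map (cover_coprime cov).
by move/coprimep_root/(_ gx); rewrite hx eqxx.
Qed.

Lemma cover_root_transcendental i : ~ algebraicOver cL (x i).
Proof.
move=> alg_x; have alg_horner (q : {poly F}) : algebraicOver cL (map_poly cL q).[x i].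
  apply/integral_algebraic/integral_horner; last exact/integral_algebraic.
  by apply/integral_poly=> k; rewrite coef_map; apply: integral_id.
have : algebraicOver cL T.
  rewrite -(mulfK (cover_root_den_neq0 i) T) cover_root_equation.
  exact: algebraic_div.
case/algebraic_polyL=> c DX; have := size_polyX F; rewrite DX.
by have := size_polyC_leq1 c; case: (size _) => [|[]].
Qed.

Lemma cover_root_wronskian_neq0 i : WL.[x i] != 0.
Proof.
apply/eqP=> Wx; apply: (cover_root_transcendental (i := i)).
by exists (wronskian g h); [apply: cover_wronskian_neq0 cov | apply/eqP].
Qed.

Lemma cover_root_inj : injective x.
Proof.
move=> i k eq_ik; apply/eqP; apply: contraNT (cover_root_wronskian_neq0 i) => neq_ik.
by have := root_wronskian_collision hL neq_ik eq_ik; rewrite -fL_factor wronskian_cover_den.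
Qed.

Lemma cover_galois : galois 1 {:L}.
Proof.
have Dcodom : fL = \prod_(z <- codom x) ('X - z%:P) by rewrite big_image.
apply/splitting_galoisField; exists fL; split.
- by apply/polyOverP=> i; rewrite coef_map polyL_mem1.
- by rewrite Dcodom separable_prod_XsubC map_inj_uniq ?enum_uniq //; apply: cover_root_inj.
- by exists (codom x); rewrite // -Dcodom eqpxx.
Qed.

Lemma gal_cover_root (s : gal_of {:L}) i : s (x i) \in codom x.
Proof. by rewrite -root_cover -(gal_map_polyL s) rmorph_root ?root_cover_root. Qed.

Definition cover_perm := gal_perm cover_root_inj gal_cover_root.
Local Notation gp := cover_perm.

Lemma cover_permE s i : x (gp s i) = s (x i).
Proof. exact: gal_permE. Qed.

Lemma cover_permM s t : gp (s * t)%g = (gp s * gp t)%g.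
Proof. exact: gal_permM. Qed.

Lemma integral_cover_root i : integralOver (@polyL F L) (x i).
Proof.
exists (cover_poly g h); last exact: root_cover_root.
by have [] := cover_poly_monic_size cov.
Qed.

Lemma stable_roots_poly (S : {set I}) : (forall s i, (gp s i \in S) = (i \in S)) ->
  exists P, map_poly (@polyL F L) P = \prod_(i in S) ('X - (x i)%:P).
Proof.
move=> stabS; apply: (invariant_integral_poly cover_galois) => [s|].
  rewrite rmorph_prod /= [RHS](reindex_inj (@perm_inj _ (gp s))) /=.
  apply: eq_big => [i|i _]; first by rewrite stabS.
  by rewrite rmorphB /= map_polyX map_polyC /= cover_permE.
by apply: integral_coef_prod_XsubC => i _; apply: integral_cover_root.
Qed.

Lemma stable_roots_trivial (S : {set I}) : (forall s i, (gp s i \in S) = (i \in S)) ->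
  S = set0 \/ S = setT.
Proof.
move=> stabS; have [P DP] := stable_roots_poly stabS.
have [Q DQ] : exists Q, map_poly (@polyL F L) Q = \prod_(i in ~: S) ('X - (x i)%:P).
  by apply: stable_roots_poly => s i; rewrite !inE stabS.
have DPQ : cover_poly g h = P * Q.
  apply: (map_inj_poly (@polyL_inj F L)); first by rewrite rmorph0.
  rewrite rmorphM /= DP DQ fL_factor (bigID (mem S)) /=; congr (_ * _).
  by apply: eq_bigl => i; rewrite inE.
have constant_empty (U : {set I}) (R : {poly {poly F}}) c :
    map_poly (@polyL F L) R = \prod_(i in U) ('X - (x i)%:P) -> swapXY R = c%:P%:P -> U = set0.
  move=> DR /(canRL (@swapXYK _)); rewrite swapXY_polyC map_polyC /= => DRc.
  apply/eqP; rewrite -cards_eq0 cardE -leqn0 -ltnS -(size_prod_XsubC _ x) big_enum -DR DRc.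
  by rewrite map_polyC size_polyC_leq1.
have : g%:P - 'X * h%:P = swapXY P * swapXY Q.
  rewrite -rmorphM -DPQ rmorphB /= -mul_polyC rmorphM /= swapXY_polyC !swapXY_map_polyC.
  by rewrite map_polyX.
case/(coprime_pencil_irreducible (cover_coprime cov)) => -[c /constant_empty].
  by move/(_ _ DP)->; left.
by move/(_ _ DQ)/(congr1 (@setC _)); rewrite setCK setC0; right.
Qed.

Lemma cover_perm_transitive i k : exists s, gp s i = k.
Proof.
pose orbit := [set gp s i | s : gal_of {:L}].
have [s j||/setP/(_ k)] := @stable_roots_trivial orbit.
- apply/imsetP/imsetP=> [[u _ Du]|[u _ ->]]; last first.
    by exists (u * s)%g; rewrite ?inE // cover_permM permM.
  exists (u * s^-1)%g; rewrite ?inE //; apply: (@perm_inj _ (gp s)).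
  by rewrite Du -permM -cover_permM mulgKV.
- by move/setP/(_ (gp 1%g i)); rewrite in_set0 imset_f ?inE.
by rewrite inE => /imsetP[s _ ->]; exists s.
Qed.

Section Residues.

Variables (pl : place L) (X : I -> place_ring pl).
Hypothesis val_X : forall i, place_val pl (X i) = x i.
Local Notation ev := (place_val pl).
Local Notation res := (place_res pl).
Local Notation iota := (place_res_const pl).
Local Notation rho i := (res (X i)).

Lemma residue_num_split : map_poly iota g = \prod_i ('X - (rho i)%:P).
Proof.
have /place_res_map_poly_eq : map_poly ev (\prod_i ('X - (X i)%:P)) =
    map_poly ev (map_poly (place_poly pl) (cover_poly g h)).
  rewrite -map_poly_comp (eq_map_poly (g := @polyL F L)) => [|q /=]; last exact: place_polyE.
  rewrite fL_factor rmorph_prod; apply: eq_bigr => i _.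
  by rewrite rmorphB /= map_polyX map_polyC /= val_X.
rewrite rmorph_prod (eq_bigr (fun i => 'X - (rho i)%:P)) => [->|i _]; last first.
  by rewrite rmorphB /= map_polyX map_polyC.
rewrite !rmorphB /= !map_polyZ /= place_resX scale0r subr0.
by rewrite -!map_poly_comp; apply: eq_map_poly.
Qed.

Lemma residue_double_zero : map_poly iota g = 'X^2 * map_poly iota v.
Proof. by rewrite (cover_double_zero cov) rmorphM /= map_polyXn. Qed.

Lemma residue_root i : rho i * (map_poly iota v).[rho i] = 0.
Proof.
have : root (map_poly iota g) (rho i).
  rewrite residue_num_split rootE horner_prod (bigD1 i) //= !hornerE subrr.
  by rewrite mul0r.
rewrite residue_double_zero rootM /root hornerXn expf_eq0 /= => /orP[/eqP->|/eqP->].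
  by rewrite mul0r.
by rewrite mulr0.
Qed.

Lemma residue_collision i k : i != k -> rho i = rho k -> rho i = 0.
Proof.
move=> neq_ik eq_ik; have := root_wronskian_collision (x := fun j => rho j)
  (map_poly iota h) neq_ik eq_ik.
rewrite -residue_num_split -map_wronskian => Wi.
have := residue_root i => /eqP; rewrite mulf_eq0 => /orP[/eqP //|vi].
have : coprimep (map_poly iota v) (map_poly iota (wronskian g h)).
  by rewrite coprimep_map (cover_wronskian_coprime cov).
by move/coprimep_root/(_ vi); rewrite (rootP Wi) eqxx.
Qed.

Lemma card_zero_residues : #|[set i | rho i == 0]| = 2%N.
Proof.
have nzv0 : ~~ root (map_poly iota v) 0.
  by rewrite -(rmorph0 iota) fmorph_root /root (cover_cofactor0 cov).
have : mup 0 (map_poly iota g) = 2%N.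
  rewrite residue_double_zero mupMl //.
  by have := mup_XsubCX 2 (0 : place_field pl) 0; rewrite polyC0 subr0 eqxx.
have -> : map_poly iota g = \prod_(z <- codom (fun i => rho i)) ('X - z%:P).
  by rewrite residue_num_split big_image.
rewrite mu_prod_XsubC => <-; rewrite count_map -sum1_count -sum1_card big_enum_cond.
by apply: eq_bigl => i; rewrite inE.
Qed.

Lemma residue_inertial_exists : exists2 s, s != 1%g & inertial pl s.
Proof.
have [i0 rho0] : exists i, rho i = 0.
  have /card_gt0P[i] : (0 < #|[set i | rho i == 0%R]|)%N by rewrite card_zero_residues.
  by rewrite inE => /eqP; exists i.
pose const := place_const pl.
apply: (inertial_exists cover_galois (x := X i0) (y := X i0 * (map_poly const v).[X i0])
  (h := (map_poly const h).[X i0])) => //.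
- rewrite !rmorphM !place_val_horner place_polyE val_X cover_root_equation.
  by rewrite (cover_double_zero cov) rmorphM /= map_polyXn hornerM hornerXn expr2 mulrA.
- rewrite place_res_horner rho0 -{1}(rmorph0 iota) horner_map fmorph_eq0.
  exact: cover_den0 cov.
move=> s c Dc; have Dk : ev (X (gp s i0)) = s (x i0) by rewrite val_X cover_permE.
rewrite (@place_res_eq _ _ _ c (X (gp s i0) * (map_poly const v).[X (gp s i0)])).
  by rewrite rmorphM place_res_horner residue_root.
rewrite Dc !rmorphM Dk val_X; congr (_ * _); rewrite !place_val_horner val_X Dk.
by rewrite -horner_map gal_map_constF.
Qed.

Lemma inertial_cover_perm s : inertial pl s -> perm_on [set i | rho i == 0] (gp s).
Proof.
move=> in_s; apply/subsetP=> i; rewrite !inE => neq_i; apply/eqP.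
apply: (@residue_collision _ (gp s i)); first by rewrite eq_sym.
by apply/esym/in_s; rewrite !val_X cover_permE.
Qed.

End Residues.

Lemma cover_perm_eq1 s : (gp s == 1%g) = (s == 1%g).
Proof.
have /injmP inj_gp := injm_gal_perm cover_root_inj gen_x gal_cover_root.
by rewrite -(morph1 (gal_perm_morphism cover_root_inj gal_cover_root)) (inj_in_eq inj_gp) ?inE.
Qed.

Lemma inertial_tperm_exists (zs : seq L) :
    (forall z, z \in zs -> integralOver (@polyL F L) z) ->
  exists (pl : place L) s a b, [/\ forall z, z \in zs -> exists c, place_val pl c = z,
    inertial pl s, a != b & gp s = tperm a b].
Proof.
move=> int_zs; have [z|pl pl_xs] := place_exists (zs := codom x ++ zs) cover_galois.
  rewrite mem_cat => /orP[/codomP[i ->]|/int_zs//].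
  exact: integral_cover_root.
have /fin_all_exists[X DX] i : exists c, place_val pl c = x i.
  by apply: pl_xs; rewrite mem_cat codom_f.
have [s nt_s in_s] := residue_inertial_exists DX.
have [|a [c [neq_ac Ds]]] := perm_on_card2 (card_zero_residues DX) (inertial_cover_perm DX in_s).
  by rewrite cover_perm_eq1.
exists pl, s, a, c; split=> // z zs_z.
by apply: pl_xs; rewrite mem_cat zs_z orbT.
Qed.

Section Valuation.

Variable w : valuation L.
Hypothesis w_const : forall c : F, c != 0 -> w (cL c) = 0.

Lemma vint_const c : cL c \in vint w.
Proof.
by have [->|nzc] := eqVneq c 0; rewrite inE ?rmorph0 ?eqxx // w_const ?lexx ?orbT.
Qed.

Lemma Nvmax_const c : c != 0 -> cL c \notin vmax w.
Proof. by move=> nzc; rewrite inE fmorph_eq0 (negPf nzc) w_const ?ltxx. Qed.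

Lemma polyOver_vint_const (q : {poly F}) : map_poly cL q \is a polyOver (vint w).
Proof. by apply/polyOverP=> i; rewrite coef_map vint_const. Qed.

(* At t = oo the cover is given by the multiple f / t of its equation. *)
Lemma integral_cover_equation : exists a y d,
  [/\ a != 0 /\ a \in 1%VS, a *: fL \is a polyOver (vint w), y \is a polyOver (vint w),
      wronskian (a *: fL) y = WL & (a *: fL)`_d \notin vmax w /\ (size g <= d.+1 + b)%N].
Proof.
have [monf szf] := cover_poly_monic_size cov.
have nzT : T != 0 by rewrite polyL_eq0 polyX_eq0.
have [OT|nOT] := boolP (T \in vint w).
  exists 1, hL, (size g).-1; rewrite scale1r; split.
  - by rewrite oner_eq0 mem1v.
  - by rewrite cover_polyE rpredB ?polyOver_vint_const // polyOverZ ?polyOver_vint_const.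
  - exact: polyOver_vint_const.
  - exact: wronskian_cover_den.
  have := monicP monf; rewrite lead_coefE szf => fd; rewrite coef_map /= fd rmorph1 Nvmax1.
  by split; rewrite // prednK ?leq_addr // (leq_trans _ (cover_size_lt cov)).
have DP : T^-1 *: fL = T^-1 *: gL - hL.
  by rewrite cover_polyE scalerBr scalerA mulVf // scale1r.
have MTV := vmaxV nOT; exists T^-1, gL, (size h).-1; split.
- by rewrite invr_eq0 nzT rpredV polyL_mem1.
- by rewrite DP rpredB ?polyOver_vint_const // polyOverZ ?polyOver_vint_const ?vmax_vint.
- exact: polyOver_vint_const.
- rewrite /wronskian derivZ -!scalerAl -scalerBr -/(wronskian fL gL) cover_polyE.
  by rewrite wronskian_pencil_r scalerA mulVf // scale1r map_wronskian.
have nzh : h != 0 by apply: contraNneq (cover_den0 cov) => ->; rewrite horner0.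
have szh : (0 < size h)%N by rewrite size_poly_gt0.
split; last by rewrite prednK // (cover_size_le cov).
rewrite DP coefB coefZ !coef_map -lead_coefE; apply: contra (Nvmax_const (_ : lead_coef h != 0)).
  move=> Mh; have MgT : T^-1 * cL g`_(size h).-1 \in vmax w.
    by rewrite mulrC; apply: vint_vmaxM (vint_const _) MTV.
  by rewrite -[cL _](subKr (T^-1 * cL g`_(size h).-1)); apply: rpredB.
by rewrite lead_coef_eq0.
Qed.

Definition unramified_at z := (z \in vint w) && (WL.[z] \notin vmax w).

Lemma count_ramified_cover_roots : (count (predC unramified_at) (codom x) <= 2 * b)%N.
Proof.
rewrite (@eq_count _ _ [pred z | (z \notin vint w) || (WL.[z] \in vmax w)]) => [|z]; last first.
  by rewrite /= negb_and negbK.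
have [a [y [d [_ OP Oy DW [nMd led]]]]] := integral_cover_equation.
have nMW : (wronskian (a *: fL) y)`_(size (wronskian g h)).-1 \notin vmax w.
  rewrite DW coef_map /= -lead_coefE Nvmax_const // lead_coef_eq0.
  exact: cover_wronskian_neq0 cov.
have DP : a *: fL = a *: \prod_(z <- codom x) ('X - z%:P) by rewrite fL_factor big_image.
have := count_ramified_roots DP OP nMd Oy nMW; rewrite DW size_map_poly size_map -cardE.
have := cover_wronskian_size cov; have [_ szf] := cover_poly_monic_size cov.
have : size fL = #|I|.+1 by rewrite fL_factor -big_enum size_prod_XsubC -cardE.
rewrite (size_map_inj_poly (@polyL_inj F L)) ?rmorph0 // szf => szg.
move: (count _ _) ((size (wronskian g h)).-1 * size (wronskian g h))%N led => m1 m2.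
by rewrite szg; move: #|I|; clear => m3; lia.
Qed.

Lemma fixedField_value_group (H : {group gal_of {:L}}) :
    (forall s, s \in H -> s != 1%g -> (2 * b < #|[set i | gp s i != i]|)%N) ->
  forall y, y != 0 -> exists2 a, a \in fixedField H & (a != 0) && (w a == w y).
Proof.
move=> moveH y nzy.
pose zs := [seq z <- codom x | unramified_at z].
have [a [u [d [[nza a1] OP Ou DW _]]]] := integral_cover_equation.
apply: (@value_group_adjoin_simple_roots _ _ w (fixedField_aspace H) (a *: fL) zs) => //.
- apply/polyOverP=> i; rewrite coefZ coef_map; apply: (subvP (sub1v (fixedField_aspace H))).
  by rewrite rpredM // polyL_mem1.
- move=> z; rewrite mem_filter => /andP[/andP[Oz nMWz] xz].
  have Pz : root (a *: fL) z by rewrite rootZ // root_cover.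
  split=> //; apply: contra nMWz => MP'z; rewrite -DW /wronskian hornerD hornerN !hornerM.
  by rewrite (rootP Pz) mul0r subr0 mulrC; apply: vint_vmaxM MP'z; apply: rpred_horner.
have gal_adjoin : galois <<fixedField H & zs>>%AS {:L}.
  apply: galoisS (fixedField_galois H); rewrite subvf andbT.
  exact: subv_adjoin_seq.
have /galois_fixedField/= <- := gal_adjoin; apply/fixedFieldP=> [|s]; first exact: memvf.
rewrite -sub1set galois_connection ?subvf // => /Fadjoin_seqP[fixH fix_zs].
suff -> : s = 1%g by rewrite gal_id.
have Hs : s \in H by rewrite -(gal_fixedField H) -sub1set galois_connection ?subvf.
apply/eqP/negPn/negP=> /(moveH s Hs); apply/negP; rewrite -leqNgt.
apply: leq_trans count_ramified_cover_roots.
rewrite count_map -sum1_count -sum1_card big_enum_cond big_mkcond [leqRHS]big_mkcond.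
apply: leq_sum => i _; rewrite inE /=; case: ifP => // neq_i.
have -> // : ~~ unramified_at (x i).
apply: contra neq_i => unram_i; apply/eqP/cover_root_inj; rewrite cover_permE.
have /fix_zs/mem_fixedFieldP[_] : x i \in zs by rewrite mem_filter unram_i codom_f.
by apply; rewrite inE.
Qed.

End Valuation.

Lemma cover_unramified (H : {group gal_of {:L}}) :
    (forall s, s \in H -> s != 1%g -> (2 * b < #|[set i | gp s i != i]|)%N) ->
  unramified (fixedField_aspace H) {:L}%AS.
Proof.
move=> moveH w [wM wD [t _ /andP[nzt /eqP wt]] wC].
have wM' (y z : L) : y != 0 -> z != 0 -> w (y * z) = w y + w z.
  by apply: wM; apply: memvf.
have wD' (y z : L) : y != 0 -> z != 0 -> y + z != 0 -> Num.min (w y) (w z) <= w (y + z).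
  by apply: wD; apply: memvf.
have [a Ha] := @fixedField_value_group (Valuation wM' wD') wC H moveH t nzt.
by rewrite /= wt; exists a.
Qed.

Hypothesis prime_card : prime #|I|.
Local Notation gpm := (gal_perm_morphism cover_root_inj gal_cover_root).

Lemma cover_perm_onto : (gpm @* setT)%g = setT.
Proof.
have [//|pl [s [a [c [_ _ neq_ac Ds]]]]] := @inertial_tperm_exists [::].
apply: (transitive_tperm_full prime_card _ neq_ac) => [i k|].
  by have [u Du] := cover_perm_transitive i k; exists (gp u); rewrite // mem_morphim ?inE.
by rewrite -Ds mem_morphim ?inE.
Qed.

(* Inertia acts trivially on constants, and the transpositions generate. *)
Lemma cover_constants y : algebraicOver cL y -> exists c, y = constF L c.
Proof.
move=> alg_y; apply: constant_mem1 => //; apply: (gal_fixed_mem1 cover_galois) => u.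
have [z|pl [s [a [c [pl_y in_s neq_ac Ds]]]]] := @inertial_tperm_exists [:: y].
  by rewrite inE => /eqP->; apply: integral_const_poly.
have {pl_y} [d Dd] : exists d, place_val pl d = y by apply: pl_y; rewrite mem_head.
have fix_s (r : gal_of {:L}) : s (r y) = r y.
  have [e De] := place_gal r d; rewrite -Dd -De; apply: inertial_fix_algebraic => //.
  by rewrite De Dd; apply: gal_algebraic.
have full : (gpm @* 'Gal({:L} / <<1; y>>))%g = setT.
  apply: (tperm_conj_full neq_ac) => t.
  have /morphimP[r _ _ ->] : t \in (gpm @* setT)%g by rewrite cover_perm_onto inE.
  rewrite -Ds -[gp s]/(gpm s) -morphJ ?inE // mem_morphim ?inE // mem_gal_adjoin.
  by rewrite conjgE !galM ?memvf // fix_s -galM ?memvf // mulVg gal_id.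
have /morphimP[r _ + /(injmP (injm_gal_perm cover_root_inj gen_x gal_cover_root))] :
  gpm u \in (gpm @* 'Gal({:L} / <<1; y>>))%g by rewrite full inE.
by rewrite mem_gal_adjoin => /eqP ry ->; rewrite ?inE.
Qed.

Lemma cover_constant_field (E : {vspace L}) : constant_field_is_F E.
Proof. by move=> y _ [q [nzq qy]]; apply: cover_constants; exists q. Qed.

Lemma cover_preim_isog (D : {group {perm I}}) : (gpm @*^-1 D \isog D)%g.
Proof.
have inj_gpm : ('injm gpm)%g := injm_gal_perm cover_root_inj gen_x gal_cover_root.
have DD : (gpm @* (gpm @*^-1 D))%g = D by rewrite morphpreK ?cover_perm_onto ?subsetT.
by rewrite -{2}DD; apply: sub_isog inj_gpm; apply: subsetT.
Qed.

End TheCover.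

Lemma cover_splits (F : fieldType) (b : nat) (g h v : {poly F}) (I : finType) :
    double_zero_cover b g h v -> size g = #|I|.+1 ->
  exists (L : splittingFieldType (ratfun F)) (x : I -> L),
    map_poly (@polyL F L) (cover_poly g h) = \prod_i ('X - (x i)%:P)
    /\ <<1 & codom x>>%VS = {:L}%VS.
Proof.
move=> cov szg; have [monf szf] := cover_poly_monic_size cov.
pose f := map_poly (@FracField.tofrac {poly F}) (cover_poly g h).
have monf' : f \is monic by rewrite monic_map.
have [L [rs Drs genL]] := splitting_field_exists (monic_neq0 monf').
have {}Drs : map_poly (@polyL F L) (cover_poly g h) = \prod_(z <- rs) ('X - z%:P).
  apply/eqP; rewrite -eqp_monic ?monic_prod_XsubC ?monic_map //.
  by rewrite -map_poly_comp in Drs.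
have sz_rs : size rs = #|I|.
  apply/eqP; rewrite -eqSS -(size_prod_XsubC rs id) -Drs.
  by rewrite (size_map_inj_poly (@polyL_inj F L)) ?rmorph0 // szf szg.
have Dcodom : codom (fun i : I => rs`_(enum_rank i)) = rs.
  apply: (eq_from_nth (x0 := 0)) => [|k]; rewrite size_codom // => ltk.
  by rewrite (nth_codom _ _ (Ordinal ltk)) enum_valK.
by exists L, (fun i => rs`_(enum_rank i)); rewrite Dcodom Drs -{1}Dcodom big_image.
Qed.

Theorem theorem3 (p : nat) (F : finFieldType) (n : nat) :
  prime p -> p \in [pchar F] -> (5 <= n)%N ->
  exists (L : splittingFieldType (ratfun F)) (k K : {subfield L}),
    [/\ constant_field_is_F k,
        constant_field_is_F K,
        galois k K,
        unramified k K
      & ('Gal(K / k) \isog [set: 'S_n])%g].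
Proof.
move=> pr_p charFp _; pose r := (2 * (p ^ 2 + p)).+1.
have [m lt_m pr_m] := prime_above (n * r + 3 * p ^ 2).
pose I : finType := ('I_n * 'I_r + 'I_(m - n * r))%type.
have cardI : #|I| = m by rewrite card_sum card_prod !card_ord subnKC //; lia.
have ndvd_pm : ~~ (p %| m)%N by rewrite dvdn_prime2 //; apply/eqP=> Dp; nia.
have [|g [h [v [cov szg]]]] := double_zero_cover_exists charFp ndvd_pm; first by lia.
have [|L [x [fL_factor gen_x]]] := @cover_splits _ _ _ _ _ I cov; first by rewrite cardI.
have prI : prime #|I| by rewrite cardI.
pose copies := copies_morphism 'I_n 'I_r 'I_(m - n * r).
pose gp := gal_perm_morphism (cover_root_inj cov fL_factor) (gal_cover_root fL_factor).
pose H := (gp @*^-1 (copies @* setT))%G.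
have moved_roots s : s \in H -> s != 1%g -> (r <= #|[set i | gp s i != i]|)%N.
  case/morphpreP=> _ /morphimP[t _ _ Ds]; rewrite -(cover_perm_eq1 cov fL_factor gen_x).
  rewrite -[cover_perm _ _ s]/(gp s) Ds -[r in (r <= _)%N]card_ord => nt_t.
  by apply: card_copies_moved; apply: contraNneq nt_t => ->; rewrite morph1.
have constant_F := cover_constant_field cov fL_factor gen_x prI.
exists L, (fixedField_aspace H), {:L}%AS; split; try exact: constant_F.
- exact: fixedField_galois.
- exact: cover_unramified moved_roots.
rewrite gal_fixedField; apply: isog_trans (cover_preim_isog cov fL_factor gen_x prI _) _.
by rewrite isog_sym sub_isog ?subsetT ?injm_copies ?card_ord.
Qed.
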